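(* Let $\{s_k\}_{k\in\mathbb{N}_0}$ be a positive sequence, let $d\in\mathbb{N}$ and $\ell_0\in 2\mathbb{N}_0$, and let $\tilde s_k=s_{kd+\ell_0}$. Let $\sigma$ be a moment solution of $\{s_k\}$. If the moment problem for $\{\tilde s_k\}$ is indeterminate, then there exists $\phi\in N$ such that for all $\lambda\in\mathbb{C}$ with $\operatorname{Im}\lambda>0$, $$\int_{-\infty}^{\infty}\frac{x^{\ell_0}\,d\sigma(x)}{x^d-\lambda}=-\frac{\tilde A(\lambda)\phi(\lambda)-\tilde C(\lambda)}{\tilde B(\lambda)\phi(\lambda)-\tilde D(\lambda)},$$ where $\tilde A,\tilde B,\tilde C,\tilde D$ is the Nevanlinna matrix of the indeterminate moment problem for $\{\tilde s_k\}$ (when $\phi\equiv\infty$ the right-hand side is read as $-\tilde A(\lambda)/\tilde B(\lambda)$).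
   Context: A sequence of real numbers is positive if all its Hankel matrices $(s_{i+j})_{i,j=0}^n$ are positive semidefinite; a moment solution is a non-decreasing $\sigma$ on $\mathbb{R}$ with $s_k=\int x^k\,d\sigma(x)$; the problem is indeterminate if it has more than one moment solution (identifying functions whose difference is constant at its continuity points). For an indeterminate positive sequence $\{\tilde s_k\}$ with a moment solution $\tilde\sigma$, let $P_k$ be the orthonormal polynomials (positive leading coefficient) with respect to $d\tilde\sigma$, and $Q_k(z)=\int\frac{P_k(z)-P_k(x)}{z-x}\,d\tilde\sigma(x)$ the polynomials of the second kind. The Nevanlinna matrix consists of the entire functions $\tilde A(z)=z\sum_{k\ge0}Q_k(0)Q_k(z)$, $\tilde B(z)=-1+z\sum_{k\ge0}Q_k(0)P_k(z)$, $\tilde C(z)=1+z\sum_{k\ge0}P_k(0)Q_k(z)$, $\tilde D(z)=z\sum_{k\ge0}P_k(0)P_k(z)$. $N$ denotes the class of functions holomorphic in the upper half-plane with nonnegative imaginary part, together with the constant $\infty$. *)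

(* Defs.v *)
From Stdlib Require Import Reals.
Open Scope R_scope.

Record Cx : Type := mkC { Re : R ; Im : R }.
Definition RtoC (x : R) : Cx := mkC x 0.
Definition C0 : Cx := RtoC 0.
Definition C1 : Cx := RtoC 1.
Definition Cadd (z w : Cx) : Cx := mkC (Re z + Re w) (Im z + Im w).
Definition Copp (z : Cx) : Cx := mkC (- Re z) (- Im z).
Definition Csub (z w : Cx) : Cx := Cadd z (Copp w).
Definition Cmul (z w : Cx) : Cx :=
  mkC (Re z * Re w - Im z * Im w) (Re z * Im w + Im z * Re w).
Definition Cinv (z : Cx) : Cx :=
  let n := Re z * Re z + Im z * Im z in mkC (Re z / n) (- Im z / n).
Definition Cdiv (z w : Cx) : Cx := Cmul z (Cinv w).
Fixpoint Cpow (z : Cx) (n : nat) : Cx :=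
  match n with O => C1 | S n => Cmul (Cpow z n) z end.
Definition Cnorm (z : Cx) : R := sqrt (Re z * Re z + Im z * Im z).

Fixpoint rsum (n : nat) (g : nat -> R) : R :=
  match n with O => 0 | S n => rsum n g + g n end.
Fixpoint csum (n : nat) (g : nat -> Cx) : Cx :=
  match n with O => C0 | S n => Cadd (csum n g) (g n) end.

Definition RS_int (f sigma : R -> R) (a b I : R) : Prop :=
  a < b /\
  forall eps, 0 < eps -> exists delta, 0 < delta /\
    forall (n : nat) (x t : nat -> R),
      x O = a -> x n = b ->
      (forall i, (i < n)%nat ->
         x i < x (S i) /\ x (S i) - x i < delta /\ x i <= t i <= x (S i)) ->
      Rabs (rsum n (fun i => f (t i) * (sigma (x (S i)) - sigma (x i))) - I) < eps.

Definition RS_int_R (f sigma : R -> R) (I : R) : Prop :=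
  (forall a b, a < b -> exists J, RS_int f sigma a b J) /\
  forall eps, 0 < eps -> exists M, forall a b J,
    a < - M -> M < b -> RS_int f sigma a b J -> Rabs (J - I) < eps.

Definition CRS_int_R (f : R -> Cx) (sigma : R -> R) (I : Cx) : Prop :=
  RS_int_R (fun x => Re (f x)) sigma (Re I) /\
  RS_int_R (fun x => Im (f x)) sigma (Im I).

Definition nondecreasing (sigma : R -> R) : Prop :=
  forall x y, x <= y -> sigma x <= sigma y.

Definition positive_seq (s : nat -> R) : Prop :=
  forall (n : nat) (v : nat -> R),
    0 <= rsum (S n) (fun i => rsum (S n) (fun j => s (i + j)%nat * v i * v j)).

Definition moment_solution (s : nat -> R) (sigma : R -> R) : Prop :=
  nondecreasing sigma /\ forall k : nat, RS_int_R (fun x => x ^ k) sigma (s k).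

Definition same_solution (s1 s2 : R -> R) : Prop :=
  exists c, forall x, continuity_pt (fun y => s1 y - s2 y) x -> s1 x - s2 x = c.

Definition indeterminate (s : nat -> R) : Prop :=
  exists s1 s2, moment_solution s s1 /\ moment_solution s s2 /\
                ~ same_solution s1 s2.

Definition pevalR (p : nat -> R) (n : nat) (x : R) : R :=
  rsum (S n) (fun j => p j * x ^ j).
Definition pevalC (p : nat -> R) (n : nat) (z : Cx) : Cx :=
  csum (S n) (fun j => Cmul (RtoC (p j)) (Cpow z j)).
(* the polynomial (p(z) - p(x)) / (z - x) in the two variables z, x *)
Definition divdiff (p : nat -> R) (n : nat) (z : Cx) (x : R) : Cx :=
  csum (S n) (fun j => Cmul (RtoC (p j))
     (csum j (fun i => Cmul (Cpow z i) (RtoC (x ^ (j - 1 - i)))))).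

Definition orthonormal_polys (sigma : R -> R) (P : nat -> nat -> R) : Prop :=
  (forall k j, (k < j)%nat -> P k j = 0) /\
  (forall k, 0 < P k k) /\
  (forall k m, RS_int_R (fun x => pevalR (P k) k x * pevalR (P m) m x) sigma
                        (if Nat.eqb k m then 1 else 0)).

Definition second_kind (sigma : R -> R) (P : nat -> nat -> R)
  (Q : nat -> Cx -> Cx) : Prop :=
  forall k z, CRS_int_R (fun x => divdiff (P k) k z x) sigma (Q k z).

Definition Cser_cv (u : nat -> Cx) (l : Cx) : Prop :=
  Un_cv (fun n => Re (csum (S n) u)) (Re l) /\
  Un_cv (fun n => Im (csum (S n) u)) (Im l).

Definition nevanlinna_matrix (P : nat -> nat -> R) (Q : nat -> Cx -> Cx)
  (A B C D : Cx -> Cx) : Prop :=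
  forall z,
    Cser_cv (fun k => Cmul z (Cmul (Q k C0) (Q k z))) (A z) /\
    Cser_cv (fun k => Cmul z (Cmul (Q k C0) (pevalC (P k) k z))) (Cadd (B z) C1) /\
    Cser_cv (fun k => Cmul z (Cmul (RtoC (pevalR (P k) k 0)) (Q k z))) (Csub (C z) C1) /\
    Cser_cv (fun k => Cmul z (Cmul (RtoC (pevalR (P k) k 0)) (pevalC (P k) k z))) (D z).

Definition upper (z : Cx) : Prop := 0 < Im z.

Definition holomorphic_upper (f : Cx -> Cx) : Prop :=
  forall z, upper z -> exists f' : Cx, forall eps, 0 < eps -> exists delta,
    0 < delta /\ forall h : Cx, h <> C0 -> Cnorm h < delta ->
      Cnorm (Csub (Cdiv (Csub (f (Cadd z h)) (f z)) h) f') < eps.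

(* None represents the constant function infinity *)
Definition in_N (phi : option (Cx -> Cx)) : Prop :=
  match phi with
  | None => True
  | Some f => holomorphic_upper f /\ forall z, upper z -> 0 <= Im (f z)
  end.

Definition nev_transform (A B C D : Cx -> Cx) (phi : option (Cx -> Cx))
  (l : Cx) : Cx :=
  match phi with
  | None => Copp (Cdiv (A l) (B l))
  | Some f => Copp (Cdiv (Csub (Cmul (A l) (f l)) (C l))
                         (Csub (Cmul (B l) (f l)) (D l)))
  end.

(* Main.v *)
From Stdlib Require Import Reals Lra Lia Classical FunctionalExtensionality.
From Coquelicot Require Import Rcomplements Rbar Hierarchy Lim_seq.
Require Import Defs.
Open Scope R_scope.

(* Pulling [sigma] back, [L f = int x^l0 f(x^d) dsigma(x)] is a positive functional whose
   moments are those of the indeterminate problem, and [w z = L (1 / (t - z))] is the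
   left-hand side.  Solving for the parameter, [phi = F / E] with [F = C + w D] and
   [E = A + w B].

   Let [g_z t = 1 / (t - z)], and let [G z y] be the inner product of the components of
   [g_z] and [g_y] orthogonal to all polynomials.  The coefficients
   [L (g_z P_k) = w z * P_k z + Q_k z] solve the recurrence of the Jacobi matrix, so the
   Christoffel-Darboux formula gives, in the limit,
     [(z - conj y) * G z y = F z * conj (E y) - E z * conj (F y)],
   in particular [Im z * G z z = Im (F z * conj (E z))], which is nonnegative.
   If [G y y = 0] for some [y], the Cauchy-Schwarz inequality for [G] shows that [F / E] is
   a real constant or infinity.  Otherwise [E] has no zero, and
     [(phi z - phi y) / (z - y) = G z (conj y) / (E z * E y)]
   has a limit as [z] tends to [y], because [g_z] is Lipschitz in [z] for the norm of [L].
   Only pointwise convergence of the Nevanlinna series is used. *)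

(** * Finite sums *)

Lemma rsum_ext n f g :
  (forall i, (i < n)%nat -> f i = g i) -> rsum n f = rsum n g.
Proof.
  induction n as [|n IH]; intros H; simpl; [easy|].
  rewrite IH, H by auto with arith. easy.
Qed.

Lemma rsum_lin n a b f g :
  rsum n (fun i => a * f i + b * g i) = a * rsum n f + b * rsum n g.
Proof. induction n as [|n IH]; simpl; [ring|rewrite IH; ring]. Qed.

Lemma rsum_scal n a f : rsum n (fun i => a * f i) = a * rsum n f.
Proof. induction n as [|n IH]; simpl; [ring|rewrite IH; ring]. Qed.

Lemma rsum_minus n f g : rsum n (fun i => f i - g i) = rsum n f - rsum n g.
Proof. induction n as [|n IH]; simpl; [ring|rewrite IH; ring]. Qed.

Lemma rsum_le n f g :
  (forall i, (i < n)%nat -> f i <= g i) -> rsum n f <= rsum n g.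
Proof.
  induction n as [|n IH]; intros H; simpl; [lra|].
  apply Rplus_le_compat; auto with arith.
Qed.

Lemma rsum_ge0 n f : (forall i, (i < n)%nat -> 0 <= f i) -> 0 <= rsum n f.
Proof.
  induction n as [|n IH]; intros H; simpl; [lra|].
  apply Rplus_le_le_0_compat; auto with arith.
Qed.

Lemma Rabs_rsum_le n f : Rabs (rsum n f) <= rsum n (fun i => Rabs (f i)).
Proof.
  induction n as [|n IH]; simpl; [rewrite Rabs_R0; lra|].
  eapply Rle_trans; [apply Rabs_triang|lra].
Qed.

Lemma rsum_plus n f g : rsum n (fun i => f i + g i) = rsum n f + rsum n g.
Proof. induction n as [|n IH]; simpl; [ring|rewrite IH; ring]. Qed.

Lemma rsum_swap n m (f : nat -> nat -> R) :
  rsum n (fun i => rsum m (f i)) = rsum m (fun j => rsum n (fun i => f i j)).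
Proof.
  induction n as [|n IH]; simpl.
  - induction m as [|m IHm]; simpl; [easy|]. rewrite <- IHm. ring.
  - rewrite IH, rsum_plus. easy.
Qed.

Lemma rsum_telescope n u : rsum n (fun i => u (S i) - u i) = u n - u O.
Proof. induction n as [|n IH]; simpl; [ring|rewrite IH; ring]. Qed.

(** * The field of complex numbers *)

Declare Scope cx_scope.
Delimit Scope cx_scope with Cx.
Bind Scope cx_scope with Cx.
Local Notation "z + w" := (Cadd z w) : cx_scope.
Local Notation "z - w" := (Csub z w) : cx_scope.
Local Notation "z * w" := (Cmul z w) : cx_scope.
Local Notation "z / w" := (Cdiv z w) : cx_scope.
Local Notation "- z" := (Copp z) : cx_scope.

Lemma Cx_eq z w : Re z = Re w -> Im z = Im w -> z = w.
Proof. destruct z, w; simpl; intros -> ->; easy. Qed.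

Definition Csqnorm (z : Cx) : R := Re z * Re z + Im z * Im z.

Lemma Csqnorm_ge0 z : 0 <= Csqnorm z.
Proof. unfold Csqnorm. nra. Qed.

Lemma Csqnorm_eq0 z : Csqnorm z = 0 -> z = C0.
Proof. unfold Csqnorm. intros H. apply Cx_eq; simpl; nra. Qed.

Lemma Csqnorm_gt0 z : z <> C0 -> 0 < Csqnorm z.
Proof.
  intros H. destruct (Csqnorm_ge0 z) as [|E]; [easy|].
  exfalso; apply H, Csqnorm_eq0; easy.
Qed.

Lemma Cx_field_theory :
  field_theory C0 C1 Cadd Cmul Csub Copp Cdiv Cinv (@eq Cx).
Proof.
  split; [split| | |]; intros.
  1-8: apply Cx_eq; simpl; ring.
  - apply Cx_eq; simpl; ring.
  - intros H. apply (f_equal Re) in H. simpl in H. lra.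
  - easy.
  - pose proof (Csqnorm_gt0 p H) as Hp. unfold Csqnorm in Hp.
    apply Cx_eq; simpl; field; lra.
Qed.

Add Field Cx_field : Cx_field_theory.

Lemma C1_neq_C0 : C1 <> C0.
Proof. exact (F_1_neq_0 Cx_field_theory). Qed.

Lemma Cmul_integral z w : (z * w)%Cx = C0 -> z = C0 \/ w = C0.
Proof.
  intros H. destruct (classic (z = C0)) as [|Hz]; [auto|right].
  replace w with ((z * w) / z)%Cx by (field; easy). rewrite H. field; easy.
Qed.

Lemma Csub_eq0 z w : (z - w)%Cx = C0 -> z = w.
Proof. intros H. replace z with ((z - w) + w)%Cx by ring. rewrite H. ring. Qed.

Lemma RtoC_mul a b : RtoC (a * b) = (RtoC a * RtoC b)%Cx.
Proof. apply Cx_eq; simpl; ring. Qed.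

Lemma Cpow_RtoC x n : Cpow (RtoC x) n = RtoC (x ^ n).
Proof.
  induction n as [|n IH]; simpl; [easy|]. rewrite IH, <- RtoC_mul. f_equal; ring.
Qed.

Definition Cconj (z : Cx) : Cx := mkC (Re z) (- Im z).

Lemma Cconj_add z w : Cconj (z + w) = (Cconj z + Cconj w)%Cx.
Proof. apply Cx_eq; simpl; ring. Qed.

Lemma Cconj_mul z w : Cconj (z * w) = (Cconj z * Cconj w)%Cx.
Proof. apply Cx_eq; simpl; ring. Qed.

Lemma Cconj_opp z : Cconj (- z) = (- Cconj z)%Cx.
Proof. apply Cx_eq; simpl; ring. Qed.

Lemma Cconj_sub z w : Cconj (z - w) = (Cconj z - Cconj w)%Cx.
Proof. apply Cx_eq; simpl; ring. Qed.

Lemma Cconj_inv z : Cconj (Cinv z) = Cinv (Cconj z).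
Proof.
  apply Cx_eq; simpl; unfold Rdiv; rewrite Rmult_opp_opp; ring.
Qed.

Lemma Cconj_RtoC x : Cconj (RtoC x) = RtoC x.
Proof. apply Cx_eq; simpl; ring. Qed.

Lemma Cconj_C0 : Cconj C0 = C0.
Proof. exact (Cconj_RtoC 0). Qed.

Lemma Cconj_C1 : Cconj C1 = C1.
Proof. exact (Cconj_RtoC 1). Qed.

Lemma Cconj_involutive z : Cconj (Cconj z) = z.
Proof. apply Cx_eq; simpl; ring. Qed.

Lemma Cconj_pow z n : Cconj (Cpow z n) = Cpow (Cconj z) n.
Proof.
  induction n as [|n IH]; simpl; [apply Cconj_RtoC|]. rewrite Cconj_mul, IH; easy.
Qed.

Lemma Cmul_conj z : (z * Cconj z)%Cx = RtoC (Csqnorm z).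
Proof. apply Cx_eq; unfold Csqnorm; simpl; ring. Qed.

Lemma Csqnorm_mul z w : Csqnorm (z * w) = Csqnorm z * Csqnorm w.
Proof. unfold Csqnorm; simpl; ring. Qed.

Lemma Csqnorm_conj z : Csqnorm (Cconj z) = Csqnorm z.
Proof. unfold Csqnorm; simpl; ring. Qed.

Lemma Csqnorm_add_le z w : Csqnorm (z + w) <= 2 * Csqnorm z + 2 * Csqnorm w.
Proof.
  unfold Csqnorm; simpl. pose proof (Rle_0_sqr (Re z - Re w)).
  pose proof (Rle_0_sqr (Im z - Im w)). unfold Rsqr in *. lra.
Qed.

Lemma Csqnorm_inv z : z <> C0 -> Csqnorm (Cinv z) = / Csqnorm z.
Proof.
  intros Hz. pose proof (Csqnorm_gt0 z Hz). unfold Csqnorm in *. simpl. field. lra.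
Qed.

Lemma Im_div z w : w <> C0 -> Im (z / w) = Im (z * Cconj w) / Csqnorm w.
Proof.
  intros Hw. pose proof (Csqnorm_gt0 _ Hw). unfold Csqnorm in *. simpl. field. lra.
Qed.

Lemma Re_sqr_le_Csqnorm z : Re z * Re z <= Csqnorm z.
Proof. unfold Csqnorm. nra. Qed.

Lemma Im_sqr_le_Csqnorm z : Im z * Im z <= Csqnorm z.
Proof. unfold Csqnorm. nra. Qed.

Lemma csum_ext n f g :
  (forall i, (i < n)%nat -> f i = g i) -> csum n f = csum n g.
Proof.
  induction n as [|n IH]; intros H; simpl; [easy|].
  rewrite IH, H by auto with arith. easy.
Qed.

Lemma csum_lin n a b f g :
  csum n (fun i => a * f i + b * g i)%Cx = (a * csum n f + b * csum n g)%Cx.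
Proof. induction n as [|n IH]; simpl; [ring|rewrite IH; ring]. Qed.

Lemma csum_scal n a f : csum n (fun i => a * f i)%Cx = (a * csum n f)%Cx.
Proof. induction n as [|n IH]; simpl; [ring|rewrite IH; ring]. Qed.

Lemma csum_zero n f : (forall i, (i < n)%nat -> f i = C0) -> csum n f = C0.
Proof.
  induction n as [|n IH]; intros H; simpl; [easy|].
  rewrite IH, H by auto with arith. ring.
Qed.

Lemma csum_plus n f g : csum n (fun i => f i + g i)%Cx = (csum n f + csum n g)%Cx.
Proof. induction n as [|n IH]; simpl; [ring|rewrite IH; ring]. Qed.

Lemma csum_swap n m (f : nat -> nat -> Cx) :
  csum n (fun i => csum m (f i)) = csum m (fun j => csum n (fun i => f i j)).
Proof.
  induction n as [|n IH]; simpl.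
  - symmetry; apply csum_zero; easy.
  - rewrite IH, csum_plus. easy.
Qed.

Lemma csum_shift n f : csum (S n) f = (f O + csum n (fun i => f (S i)))%Cx.
Proof.
  induction n as [|n IH]; [simpl; ring|].
  change (csum (S (S n)) f) with (csum (S n) f + f (S n))%Cx. rewrite IH. simpl. ring.
Qed.

Definition kronecker (j k : nat) : Cx := if Nat.eqb j k then C1 else C0.

Lemma kronecker_diag k : kronecker k k = C1.
Proof. unfold kronecker. rewrite Nat.eqb_refl. easy. Qed.

Lemma kronecker_neq j k : j <> k -> kronecker j k = C0.
Proof. unfold kronecker. intros H. apply Nat.eqb_neq in H. rewrite H. easy. Qed.

Lemma csum_kronecker n k f : (k < n)%nat ->
  csum n (fun j => f j * kronecker j k)%Cx = f k.
Proof.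
  induction n as [|n IH]; intros Hk; [lia|]. simpl.
  destruct (Nat.eq_dec k n) as [->|Hkn].
  - rewrite kronecker_diag, csum_zero; [ring|].
    intros j Hj. rewrite kronecker_neq by lia. ring.
  - rewrite IH, kronecker_neq by lia. ring.
Qed.

Lemma Cconj_csum n f : Cconj (csum n f) = csum n (fun i => Cconj (f i)).
Proof.
  induction n as [|n IH]; simpl; [apply Cconj_RtoC|]. rewrite Cconj_add, IH; easy.
Qed.

(** * Limits along a filter *)

Section RealFilterlim.

Context {T : Type} {F : (T -> Prop) -> Prop} {FF : Filter F}.
Implicit Types u v : T -> R.

Lemma filterlim_Rplus u v a b :
  filterlim u F (locally a) -> filterlim v F (locally b) ->
  filterlim (fun x => u x + v x) F (locally (a + b)).
Proof.
  intros Hu Hv. apply (filterlim_comp_2 u v Rplus Hu Hv).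
  exact (@filterlim_plus _ R_NormedModule a b).
Qed.

Lemma filterlim_Rmult u v a b :
  filterlim u F (locally a) -> filterlim v F (locally b) ->
  filterlim (fun x => u x * v x) F (locally (a * b)).
Proof.
  intros Hu Hv. apply (filterlim_comp_2 u v Rmult Hu Hv).
  exact (@filterlim_mult R_AbsRing a b).
Qed.

Lemma filterlim_Ropp u a :
  filterlim u F (locally a) -> filterlim (fun x => - u x) F (locally (- a)).
Proof.
  intros Hu. eapply filterlim_comp; [exact Hu|].
  exact (@filterlim_opp _ R_NormedModule a).
Qed.

Lemma filterlim_Rminus u v a b :
  filterlim u F (locally a) -> filterlim v F (locally b) ->
  filterlim (fun x => u x - v x) F (locally (a - b)).
Proof. intros Hu Hv. apply filterlim_Rplus; [|apply filterlim_Ropp]; easy. Qed.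

Lemma filterlim_Rinv u a : a <> 0 ->
  filterlim u F (locally a) -> filterlim (fun x => / u x) F (locally (/ a)).
Proof.
  intros Ha Hu. eapply filterlim_comp; [exact Hu|].
  apply (filterlim_Rbar_inv (Finite a)). intros E. inversion E. easy.
Qed.

Lemma filterlim_locally_Rabs u a :
  filterlim u F (locally a) <->
  forall eps, 0 < eps -> F (fun x => Rabs (u x - a) < eps).
Proof.
  rewrite filterlim_locally. split.
  - intros H eps He. exact (H (mkposreal eps He)).
  - intros H eps. exact (H eps (cond_pos eps)).
Qed.

End RealFilterlim.

Lemma filterlim_Rle {T} {F : (T -> Prop) -> Prop} {FF : ProperFilter F} (u v : T -> R) a b :
  (forall x, u x <= v x) ->
  filterlim u F (locally a) -> filterlim v F (locally b) -> a <= b.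
Proof.
  intros H Hu Hv. apply (filterlim_le (F := F) u v (Finite a) (Finite b)); auto.
  apply filter_forall. easy.
Qed.

Definition Cfilterlim {T : Type} (u : T -> Cx) (F : (T -> Prop) -> Prop) (l : Cx) : Prop :=
  filterlim (fun x => Re (u x)) F (locally (Re l)) /\
  filterlim (fun x => Im (u x)) F (locally (Im l)).

Section ComplexFilterlim.

Context {T : Type} {F : (T -> Prop) -> Prop} {FF : Filter F}.
Implicit Types u v : T -> Cx.

Lemma Cfilterlim_ext_loc u v l :
  F (fun x => u x = v x) -> Cfilterlim u F l -> Cfilterlim v F l.
Proof.
  intros H [HRe HIm].
  split; (eapply filterlim_ext_loc; [|eassumption]);
    apply filter_imp with (2 := H); intros x ->; easy.
Qed.

Lemma Cfilterlim_ext u v l :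
  (forall x, u x = v x) -> Cfilterlim u F l -> Cfilterlim v F l.
Proof. intros H. apply Cfilterlim_ext_loc, filter_forall, H. Qed.

Lemma Cfilterlim_const z : Cfilterlim (fun _ => z) F z.
Proof. split; apply filterlim_const. Qed.

Lemma Cfilterlim_add u v a b :
  Cfilterlim u F a -> Cfilterlim v F b -> Cfilterlim (fun x => u x + v x)%Cx F (a + b)%Cx.
Proof. intros [U1 U2] [V1 V2]. split; apply filterlim_Rplus; easy. Qed.

Lemma Cfilterlim_mul u v a b :
  Cfilterlim u F a -> Cfilterlim v F b -> Cfilterlim (fun x => u x * v x)%Cx F (a * b)%Cx.
Proof.
  intros [U1 U2] [V1 V2]. split.
  - apply filterlim_Rminus; apply filterlim_Rmult; easy.
  - apply filterlim_Rplus; apply filterlim_Rmult; easy.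
Qed.

Lemma Cfilterlim_opp u a : Cfilterlim u F a -> Cfilterlim (fun x => - u x)%Cx F (- a)%Cx.
Proof. intros [U1 U2]. split; apply filterlim_Ropp; easy. Qed.

Lemma Cfilterlim_sub u v a b :
  Cfilterlim u F a -> Cfilterlim v F b -> Cfilterlim (fun x => u x - v x)%Cx F (a - b)%Cx.
Proof. intros Hu Hv. apply Cfilterlim_add; [|apply Cfilterlim_opp]; easy. Qed.

Lemma Cfilterlim_conj u a : Cfilterlim u F a -> Cfilterlim (fun x => Cconj (u x)) F (Cconj a).
Proof. intros [U1 U2]. split; [|apply filterlim_Ropp]; easy. Qed.

Lemma filterlim_Csqnorm u a :
  Cfilterlim u F a -> filterlim (fun x => Csqnorm (u x)) F (locally (Csqnorm a)).
Proof. intros [U1 U2]. apply filterlim_Rplus; apply filterlim_Rmult; easy. Qed.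

Lemma Cfilterlim_inv u a : a <> C0 ->
  Cfilterlim u F a -> Cfilterlim (fun x => Cinv (u x)) F (Cinv a).
Proof.
  intros Ha Hu.
  pose proof (filterlim_Rinv _ _ (Rgt_not_eq _ _ (Csqnorm_gt0 a Ha)) (filterlim_Csqnorm u a Hu)).
  destruct Hu as [U1 U2].
  split; apply filterlim_Rmult; auto. apply filterlim_Ropp; easy.
Qed.

Lemma Cfilterlim_div u v a b : b <> C0 ->
  Cfilterlim u F a -> Cfilterlim v F b -> Cfilterlim (fun x => u x / v x)%Cx F (a / b)%Cx.
Proof. intros Hb Hu Hv. apply Cfilterlim_mul; [|apply Cfilterlim_inv]; easy. Qed.

Lemma Cfilterlim_Cnorm_sub u a : Cfilterlim u F a ->
  forall eps, 0 < eps -> F (fun x => Cnorm (u x - a) < eps).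
Proof.
  intros Hu eps He.
  pose proof (filterlim_Csqnorm _ _ (Cfilterlim_sub u _ a _ Hu (Cfilterlim_const a))) as Hn.
  rewrite (filterlim_locally_Rabs (F := F)) in Hn.
  apply filter_imp with (2 := Hn (eps * eps) ltac:(nra)). intros x Hx.
  replace (Csqnorm (a - a)) with 0 in Hx by (unfold Csqnorm; simpl; ring).
  apply Rabs_def2 in Hx. change (sqrt (Csqnorm (u x - a)) < eps).
  rewrite <- (sqrt_square eps) by lra. apply sqrt_lt_1; [apply Csqnorm_ge0|nra|lra].
Qed.

Lemma Cfilterlim_of_Csqnorm_sub u a :
  filterlim (fun x => Csqnorm (u x - a)) F (locally 0) -> Cfilterlim u F a.
Proof.
  intros H. rewrite (filterlim_locally_Rabs (F := F)) in H.
  assert (Component : forall y z : R, y * y <= z -> forall eps, 0 < eps ->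
    Rabs (z - 0) < eps * eps -> Rabs y < eps).
  { intros y z Hyz eps He Hz. rewrite <- (Rabs_pos_eq eps) by lra.
    apply Rsqr_lt_abs_0. apply Rabs_def2 in Hz. unfold Rsqr. lra. }
  split; apply filterlim_locally_Rabs; intros eps He;
    (apply filter_imp with (2 := H (eps * eps) ltac:(nra)));
    intros x; apply Component; try easy.
  - apply (Re_sqr_le_Csqnorm (u x - a)).
  - apply (Im_sqr_le_Csqnorm (u x - a)).
Qed.

End ComplexFilterlim.

Lemma Cfilterlim_unique {T} {F : (T -> Prop) -> Prop} {FF : ProperFilter F} (u : T -> Cx) a b :
  Cfilterlim u F a -> Cfilterlim u F b -> a = b.
Proof.
  intros [A1 A2] [B1 B2].
  apply Cx_eq; eapply (filterlim_locally_unique (F := F) (V := R_NormedModule)); eassumption.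
Qed.

Lemma Cfilterlim_S u l :
  Cfilterlim u eventually l -> Cfilterlim (fun n => u (S n)) eventually l.
Proof.
  intros [HRe HIm]. split.
  - exact (proj1 (is_lim_seq_incr_1 (fun n => Re (u n)) (Finite (Re l))) HRe).
  - exact (proj1 (is_lim_seq_incr_1 (fun n => Im (u n)) (Finite (Im l))) HIm).
Qed.

(** * Riemann-Stieltjes sums and integrals *)

Record partition : Type := Partition { cells : nat; node : nat -> R; tag : nat -> R }.

Definition fine_partition (a b delta : R) (p : partition) : Prop :=
  node p O = a /\ node p (cells p) = b /\
  forall i, (i < cells p)%nat ->
    node p i < node p (S i) /\ node p (S i) - node p i < delta /\
    node p i <= tag p i <= node p (S i).

Definition mesh_filter (a b : R) (Q : partition -> Prop) : Prop :=
  exists delta, 0 < delta /\ forall p, fine_partition a b delta p -> Q p.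

Definition RS_sum (f s : R -> R) (p : partition) : R :=
  rsum (cells p) (fun i => f (tag p i) * (s (node p (S i)) - s (node p i))).

Lemma fine_partition_exists a b delta : a < b -> 0 < delta ->
  exists p, fine_partition a b delta p.
Proof.
  intros Hab Hd. destruct (INR_unbounded ((b - a) / delta)) as [n Hn].
  assert (0 < (b - a) / delta) by (apply Rdiv_lt_0_compat; lra).
  assert (Hmesh : (b - a) / INR n < delta).
  { apply Rmult_lt_reg_r with (INR n); [lra|].
    replace ((b - a) / INR n * INR n) with ((b - a) / delta * delta) by (field; lra). nra. }
  assert (0 < (b - a) / INR n) by (apply Rdiv_lt_0_compat; lra).
  set (x := fun i => a + INR i * ((b - a) / INR n)).
  exists (Partition n x x). unfold fine_partition, x. cbn [cells node tag].
  split; [simpl; ring|]. split; [field; lra|]. intros i _. rewrite S_INR. lra.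
Qed.

Lemma mesh_filter_proper a b : a < b -> ProperFilter (mesh_filter a b).
Proof.
  intros Hab. split.
  - intros Q (d & Hd & HQ). destruct (fine_partition_exists a b d Hab Hd) as [p Hp].
    exists p. auto.
  - split.
    + exists 1. split; [lra|easy].
    + intros Q Q' (d & Hd & HQ) (d' & Hd' & HQ').
      exists (Rmin d d'). split; [apply Rmin_glb_lt; easy|].
      pose proof (Rmin_l d d'). pose proof (Rmin_r d d').
      intros p (Ha & Hb & Hp).
      split; [apply HQ|apply HQ']; (split; [easy|split; [easy|]]);
        intros i Hi; specialize (Hp i Hi); lra.
    + intros Q Q' H (d & Hd & HQ). exists d. auto.
Qed.

Lemma RS_int_filterlim f s a b I : RS_int f s a b I <->
  a < b /\ filterlim (RS_sum f s) (mesh_filter a b) (locally I).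
Proof.
  split; intros [Hab H]; (split; [easy|]); pose proof (mesh_filter_proper a b Hab).
  - apply (filterlim_locally_Rabs (F := mesh_filter a b)). intros eps He.
    destruct (H eps He) as (d & Hd & HI). exists d. split; [easy|].
    intros p (Ha & Hb & Hp). apply HI; easy.
  - rewrite (filterlim_locally_Rabs (F := mesh_filter a b)) in H. intros eps He.
    destruct (H eps He) as (d & Hd & HI). exists d. split; [easy|].
    intros n x t Ha Hb Hp. apply (HI (Partition n x t)). split; easy.
Qed.

Lemma RS_int_unique f s a b I J : RS_int f s a b I -> RS_int f s a b J -> I = J.
Proof.
  rewrite !RS_int_filterlim. intros [Hab HI] [_ HJ].
  pose proof (mesh_filter_proper a b Hab).
  apply (filterlim_locally_unique (F := mesh_filter a b) (V := R_NormedModule) (RS_sum f s));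
    easy.
Qed.

Lemma RS_int_lin f g s a b p q I J :
  RS_int f s a b I -> RS_int g s a b J ->
  RS_int (fun x => p * f x + q * g x) s a b (p * I + q * J).
Proof.
  rewrite !RS_int_filterlim. intros [Hab HI] [_ HJ]. split; [easy|].
  pose proof (mesh_filter_proper a b Hab).
  apply (filterlim_ext (fun P => p * RS_sum f s P + q * RS_sum g s P)).
  - intros P. unfold RS_sum. rewrite <- rsum_lin. apply rsum_ext; intros; ring.
  - apply filterlim_Rplus; (apply filterlim_Rmult; [apply filterlim_const|easy]).
Qed.

Lemma RS_int_ge0 f s a b I : nondecreasing s -> (forall x, 0 <= f x) ->
  RS_int f s a b I -> 0 <= I.
Proof.
  rewrite RS_int_filterlim. intros Hs Hf [Hab HI]. pose proof (mesh_filter_proper a b Hab).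
  apply (filterlim_le (F := mesh_filter a b) (fun _ => 0) (RS_sum f s) (Finite 0) (Finite I));
    [|apply filterlim_const|easy].
  exists 1. split; [lra|]. intros p (_ & _ & Hp).
  apply rsum_ge0. intros i Hi. specialize (Hp i Hi).
  pose proof (Hs (node p i) (node p (S i)) ltac:(lra)). apply Rmult_le_pos; [easy|lra].
Qed.

Lemma fine_partition_node_le a b delta p i j : fine_partition a b delta p ->
  (i <= j <= cells p)%nat -> node p i <= node p j.
Proof.
  intros (_ & _ & Hp) [Hij Hj]. induction Hij as [|j Hij IH]; [lra|].
  specialize (IH ltac:(lia)). specialize (Hp j Hj). lra.
Qed.

Lemma fine_partition_node_range a b delta p i : fine_partition a b delta p ->
  (i <= cells p)%nat -> a <= node p i <= b.
Proof.
  intros Hp Hi. pose proof Hp as (<- & <- & _).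
  split; apply (fine_partition_node_le _ _ _ _ _ _ Hp); lia.
Qed.

Definition clamp (u v x : R) : R := Rmax u (Rmin v x).

Ltac unclamp := unfold clamp, Rmax, Rmin; repeat destruct Rle_dec; try lra.

Definition overlap_mass (s : R -> R) (u v y y' : R) : R :=
  s (clamp u v y') - s (clamp u v y).

Lemma overlap_mass_sym s u v y y' : u <= v -> y <= y' ->
  overlap_mass s u v y y' = overlap_mass s y y' u v.
Proof.
  intros Huv Hyy. unfold overlap_mass.
  destruct (Rle_dec y' u); [|destruct (Rle_dec v y)].
  - replace (clamp u v y') with u by unclamp. replace (clamp u v y) with u by unclamp.
    replace (clamp y y' v) with y' by unclamp. replace (clamp y y' u) with y' by unclamp. ring.
  - replace (clamp u v y') with v by unclamp. replace (clamp u v y) with v by unclamp.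
    replace (clamp y y' v) with y by unclamp. replace (clamp y y' u) with y by unclamp. ring.
  - f_equal; f_equal; unclamp.
Qed.

Section OverlapMass.

Variable s : R -> R.
Hypothesis Hs : nondecreasing s.

Lemma overlap_mass_ge0 u v y y' : y <= y' -> 0 <= overlap_mass s u v y y'.
Proof.
  intros Hyy. unfold overlap_mass.
  assert (s (clamp u v y) <= s (clamp u v y')) by (apply Hs; unclamp). lra.
Qed.

Lemma overlap_mass_le u v y y' : u <= v -> y <= y' ->
  overlap_mass s u v y y' <= s y' - s y.
Proof.
  intros Huv Hyy. rewrite overlap_mass_sym by easy. unfold overlap_mass.
  assert (s (clamp y y' v) <= s y') by (apply Hs; unclamp).
  assert (s y <= s (clamp y y' u)) by (apply Hs; unclamp). lra.
Qed.

End OverlapMass.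

Lemma overlap_mass_inside s u v y y' : y <= u -> u <= v -> v <= y' ->
  overlap_mass s u v y y' = s v - s u.
Proof. intros. unfold overlap_mass. f_equal; f_equal; unclamp. Qed.

Lemma overlap_mass_disjoint s u v y y' : u <= v -> y <= y' -> v < y \/ y' < u ->
  overlap_mass s u v y y' = 0.
Proof.
  intros Huv Hyy H. unfold overlap_mass.
  replace (clamp u v y') with (clamp u v y) by (destruct H; unclamp). ring.
Qed.

Section ClampedIntegrator.

Variables (f s : R -> R) (a b a' b' delta eps : R) (p q : partition).
Hypothesis Hs : nondecreasing s.
Hypothesis Hp : fine_partition a b delta p.
Hypothesis Hq : fine_partition a' b' delta q.
Hypotheses (Haa : a' <= a) (Hbb : b <= b').
Hypothesis f_close : forall x y, a' <= x <= b' -> a' <= y <= b' ->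
  Rabs (x - y) < delta + delta -> Rabs (f x - f y) <= eps.

Let M (i j : nat) : R :=
  overlap_mass s (node p i) (node p (S i)) (node q j) (node q (S j)).

Lemma overlap_mass_row i : (i < cells p)%nat ->
  rsum (cells q) (M i) = s (node p (S i)) - s (node p i).
Proof.
  intros Hi. unfold M, overlap_mass.
  rewrite (rsum_telescope _ (fun j => s (clamp (node p i) (node p (S i)) (node q j)))).
  pose proof (fine_partition_node_range _ _ _ _ i Hp ltac:(lia)).
  pose proof (fine_partition_node_range _ _ _ _ (S i) Hp Hi).
  pose proof (fine_partition_node_le _ _ _ _ i (S i) Hp ltac:(lia)).
  destruct Hq as (-> & -> & _). apply overlap_mass_inside; lra.
Qed.

Lemma overlap_mass_column j : (j < cells q)%nat ->
  rsum (cells p) (fun i => M i j) = overlap_mass s a b (node q j) (node q (S j)).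
Proof.
  intros Hj. unfold M.
  pose proof (fine_partition_node_le _ _ _ _ j (S j) Hq ltac:(lia)).
  rewrite (rsum_ext _ _ (fun i => overlap_mass s (node q j) (node q (S j))
      (node p i) (node p (S i)))).
  - unfold overlap_mass at 1.
    rewrite (rsum_telescope _ (fun i => s (clamp (node q j) (node q (S j)) (node p i)))).
    pose proof (fine_partition_node_le _ _ _ _ 0 (cells p) Hp ltac:(lia)) as Hab.
    destruct Hp as (Ha & Hb & _). rewrite Ha, Hb in *.
    rewrite overlap_mass_sym by easy. easy.
  - intros i Hi. apply overlap_mass_sym; [|easy].
    apply (fine_partition_node_le _ _ _ _ _ _ Hp). lia.
Qed.

Lemma overlap_oscillation_le i j : (i < cells p)%nat -> (j < cells q)%nat ->
  Rabs ((f (tag p i) - f (tag q j)) * M i j) <= eps * M i j.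
Proof.
  intros Hi Hj.
  pose proof (fine_partition_node_range _ _ _ _ i Hp ltac:(lia)).
  pose proof (fine_partition_node_range _ _ _ _ (S i) Hp Hi).
  pose proof (fine_partition_node_range _ _ _ _ j Hq ltac:(lia)).
  pose proof (fine_partition_node_range _ _ _ _ (S j) Hq Hj).
  destruct Hp as (_ & _ & Hpi), Hq as (_ & _ & Hqj).
  specialize (Hpi i Hi). specialize (Hqj j Hj).
  destruct (classic (node p (S i) < node q j \/ node q (S j) < node p i)) as [Hd|Hd].
  - unfold M. rewrite overlap_mass_disjoint by (try lra; easy).
    rewrite !Rmult_0_r, Rabs_R0. lra.
  - assert (0 <= M i j) by (apply overlap_mass_ge0; [easy|lra]).
    rewrite Rabs_mult, (Rabs_pos_eq (M i j)) by easy.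
    apply Rmult_le_compat_r; [easy|]. apply f_close; try lra. apply Rabs_def1; lra.
Qed.

Lemma RS_sum_clamp_close :
  Rabs (RS_sum f s p - RS_sum f (fun x => s (clamp a b x)) q) <= eps * (s b - s a).
Proof.
  assert (Rows : RS_sum f s p =
    rsum (cells p) (fun i => rsum (cells q) (fun j => f (tag p i) * M i j))).
  { apply rsum_ext. intros i Hi. rewrite rsum_scal, overlap_mass_row by easy. easy. }
  assert (Columns : RS_sum f (fun x => s (clamp a b x)) q =
    rsum (cells p) (fun i => rsum (cells q) (fun j => f (tag q j) * M i j))).
  { rewrite rsum_swap. apply rsum_ext. intros j Hj.
    rewrite rsum_scal, overlap_mass_column by easy. easy. }
  assert (Mass : rsum (cells p) (fun i => rsum (cells q) (M i)) = s b - s a).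
  { rewrite (rsum_ext _ _ _ overlap_mass_row), (rsum_telescope _ (fun i => s (node p i))).
    destruct Hp as (-> & -> & _). easy. }
  rewrite Rows, Columns, <- rsum_minus, <- Mass, <- rsum_scal.
  eapply Rle_trans; [apply Rabs_rsum_le|]. apply rsum_le. intros i Hi.
  rewrite <- rsum_minus, <- rsum_scal.
  eapply Rle_trans; [apply Rabs_rsum_le|]. apply rsum_le. intros j Hj.
  rewrite <- Rmult_minus_distr_r. apply overlap_oscillation_le; easy.
Qed.

End ClampedIntegrator.

(* Replacing the integrator by [s (clamp a b x)] compares sums over [[a, b]] with sums over
   a larger interval without forming a common refinement of the two partitions. *)
Lemma RS_sum_clamp_near f s a b a' b' eps : continuity f -> nondecreasing s ->
  a' <= a -> a < b -> b <= b' -> 0 < eps ->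
  exists delta, 0 < delta /\ forall p q,
    fine_partition a b delta p -> fine_partition a' b' delta q ->
    Rabs (RS_sum f s p - RS_sum f (fun x => s (clamp a b x)) q) <= eps.
Proof.
  intros Hf Hs Ha Hab Hb He. pose proof (Hs a b ltac:(lra)) as HV.
  set (e := eps / (s b - s a + 1)).
  assert (He' : 0 < e) by (apply Rdiv_lt_0_compat; lra).
  assert (e * (s b - s a + 1) = eps) by (unfold e; field; lra).
  destruct (Heine f (fun c => a' <= c <= b') (compact_P3 a' b') (fun x _ => Hf x)
    (mkposreal e He')) as [d Hd].
  pose proof (cond_pos d). exists (d / 2). split; [lra|]. intros p q Hp Hq.
  apply Rle_trans with (e * (s b - s a)); [|lra].
  apply (RS_sum_clamp_close f s a b a' b' (d / 2)); auto.
  intros x y Hx Hy Hxy. left. apply Hd; auto. lra.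
Qed.

Lemma RS_sum_clamp_id f s a b delta p : fine_partition a b delta p ->
  RS_sum f (fun x => s (clamp a b x)) p = RS_sum f s p.
Proof.
  intros Hp. apply rsum_ext. intros i Hi.
  pose proof (fine_partition_node_range _ _ _ _ i Hp ltac:(lia)).
  pose proof (fine_partition_node_range _ _ _ _ (S i) Hp Hi).
  do 2 f_equal; f_equal; unclamp.
Qed.

Lemma RS_sum_clamp_le f s a b a' b' delta p : nondecreasing s -> (forall x, 0 <= f x) ->
  a <= b -> fine_partition a' b' delta p ->
  RS_sum f (fun x => s (clamp a b x)) p <= RS_sum f s p.
Proof.
  intros Hs Hf Hab (_ & _ & Hp). apply rsum_le. intros i Hi. specialize (Hp i Hi).
  apply Rmult_le_compat_l; [easy|]. apply overlap_mass_le; auto; lra.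
Qed.

Lemma RS_int_exists f s a b : continuity f -> nondecreasing s -> a < b ->
  exists I, RS_int f s a b I.
Proof.
  intros Hf Hs Hab. pose proof (mesh_filter_proper a b Hab).
  destruct (proj1 (filterlim_locally_cauchy (F := mesh_filter a b) (U := R_CompleteSpace)
    (RS_sum f s))) as [I HI]; [|exists I; apply RS_int_filterlim; easy].
  intros eps. pose proof (cond_pos eps).
  destruct (RS_sum_clamp_near f s a b a b (eps / 2)) as (d & Hd & Hnear); auto; try lra.
  exists (fine_partition a b d). split; [exists d; auto|]. intros p q Hp Hq.
  specialize (Hnear q p Hq Hp). rewrite (RS_sum_clamp_id f s a b d p Hp) in Hnear.
  change (Rabs (RS_sum f s q - RS_sum f s p) < eps). lra.
Qed.

Lemma RS_int_interval_mono f s a b a' b' I J : nondecreasing s ->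
  continuity f -> (forall x, 0 <= f x) -> a' <= a -> b <= b' ->
  RS_int f s a b I -> RS_int f s a' b' J -> I <= J.
Proof.
  rewrite !RS_int_filterlim. intros Hs Hc Hf Ha Hb [Hab HI] [Hab' HJ].
  pose proof (mesh_filter_proper a b Hab). pose proof (mesh_filter_proper a' b' Hab').
  apply le_epsilon. intros eps He.
  apply (filterlim_le (F := filter_prod (mesh_filter a b) (mesh_filter a' b'))
    (fun pq => RS_sum f s (fst pq)) (fun pq => RS_sum f s (snd pq) + eps)
    (Finite I) (Finite (J + eps))).
  - destruct (RS_sum_clamp_near f s a b a' b' eps) as (d & Hd & Hnear); auto.
    apply Filter_prod with (fine_partition a b d) (fine_partition a' b' d);
      [exists d; auto|exists d; auto|]. intros p q Hp Hq. simpl.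
    pose proof (Rle_abs (RS_sum f s p - RS_sum f (fun x => s (clamp a b x)) q)).
    pose proof (Hnear p q Hp Hq).
    pose proof (RS_sum_clamp_le f s a b a' b' d q Hs Hf ltac:(lra) Hq). lra.
  - exact (filterlim_comp _ _ _ fst (RS_sum f s) _ _ _ filterlim_fst HI).
  - apply filterlim_Rplus; [|apply filterlim_const].
    exact (filterlim_comp _ _ _ snd (RS_sum f s) _ _ _ filterlim_snd HJ).
Qed.

(** * Improper integrals *)

Definition RS_value (f s : R -> R) (a b : R) : R := @iota R_CompleteSpace (RS_int f s a b).

Lemma RS_int_value f s a b I : RS_int f s a b I -> RS_int f s a b (RS_value f s a b).
Proof.
  intros HI. apply (@iota_correct R_AbsRing R_CompleteNormedModule (RS_int f s a b)).
  exists I. split; [easy|]. intros J. apply RS_int_unique; easy.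
Qed.

Lemma RS_value_unique f s a b I : RS_int f s a b I -> RS_value f s a b = I.
Proof.
  intros HI. apply (RS_int_unique f s a b); [|easy]. apply RS_int_value with I; easy.
Qed.

Definition whole_line (Q : R * R -> Prop) : Prop :=
  exists M, 0 <= M /\ forall a b, a < - M -> M < b -> Q (a, b).

#[local] Instance whole_line_proper : ProperFilter whole_line.
Proof.
  split; [|split].
  - intros Q (M & HM & HQ). exists (- M - 1, M + 1). apply HQ; lra.
  - exists 0. split; [lra|easy].
  - intros Q Q' (M & HM & HQ) (M' & HM' & HQ').
    pose proof (Rmax_l M M'). pose proof (Rmax_r M M').
    exists (Rmax M M'). split; [lra|]. intros a b Ha Hb. split; [apply HQ|apply HQ']; lra.
  - intros Q Q' H (M & HM & HQ). exists M. auto.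
Qed.

Definition RS_integrable_on_segments (f s : R -> R) : Prop :=
  forall a b, a < b -> RS_int f s a b (RS_value f s a b).

Lemma RS_int_R_filterlim f s I : RS_int_R f s I <->
  RS_integrable_on_segments f s /\
  filterlim (fun ab => RS_value f s (fst ab) (snd ab)) whole_line (locally I).
Proof.
  rewrite (filterlim_locally_Rabs (F := whole_line)). split; intros [Hex Hlim].
  - assert (Hval : RS_integrable_on_segments f s).
    { intros a b Hab. destruct (Hex a b Hab) as [J HJ]. apply RS_int_value with J; easy. }
    split; [easy|]. intros eps He. destruct (Hlim eps He) as [M HM].
    pose proof (Rmax_l 0 M). pose proof (Rmax_r 0 M).
    exists (Rmax 0 M). split; [easy|]. intros a b Ha Hb.
    apply (HM a b); try lra. apply Hval. simpl. lra.
  - split; [intros a b Hab; exists (RS_value f s a b); auto|].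
    intros eps He. destruct (Hlim eps He) as (M & _ & HM). exists M.
    intros a b J Ha Hb HJ. rewrite <- (RS_value_unique _ _ _ _ _ HJ). apply HM; easy.
Qed.

Lemma RS_int_R_ext f g s I : (forall x, f x = g x) -> RS_int_R f s I -> RS_int_R g s I.
Proof. intros H. replace g with f by (extensionality x; easy). easy. Qed.

Lemma RS_int_R_unique f s I J : RS_int_R f s I -> RS_int_R f s J -> I = J.
Proof.
  rewrite !RS_int_R_filterlim. intros [_ HI] [_ HJ].
  exact (filterlim_locally_unique (F := whole_line) (V := R_NormedModule) _ _ _ HI HJ).
Qed.

Lemma whole_line_nonempty_segment : whole_line (fun ab => fst ab < snd ab).
Proof. exists 0. split; [lra|]. simpl. intros; lra. Qed.

Lemma RS_int_R_lin f g s p q I J : RS_int_R f s I -> RS_int_R g s J ->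
  RS_int_R (fun x => p * f x + q * g x) s (p * I + q * J).
Proof.
  rewrite !RS_int_R_filterlim. intros [Hf HI] [Hg HJ].
  assert (Hlin : forall a b, a < b -> RS_int (fun x => p * f x + q * g x) s a b
    (p * RS_value f s a b + q * RS_value g s a b)) by (intros; apply RS_int_lin; auto).
  split; [intros a b Hab; apply RS_int_value with (1 := Hlin a b Hab)|].
  apply (filterlim_ext_loc (F := whole_line) (fun ab =>
    p * RS_value f s (fst ab) (snd ab) + q * RS_value g s (fst ab) (snd ab))).
  - apply filter_imp with (2 := whole_line_nonempty_segment). intros ab Hab.
    symmetry. apply RS_value_unique, Hlin, Hab.
  - apply filterlim_Rplus; (apply filterlim_Rmult; [apply filterlim_const|easy]).
Qed.

Lemma RS_int_R_ge0 f s I : nondecreasing s -> (forall x, 0 <= f x) ->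
  RS_int_R f s I -> 0 <= I.
Proof.
  rewrite RS_int_R_filterlim. intros Hs Hf [Hval HI].
  apply (filterlim_le (F := whole_line) (fun _ => 0)
    (fun ab => RS_value f s (fst ab) (snd ab)) (Finite 0) (Finite I));
    [|apply filterlim_const|easy].
  apply filter_imp with (2 := whole_line_nonempty_segment). intros [a b] Hab.
  apply (RS_int_ge0 f s a b); auto.
Qed.

Section Dominated.

Variables (f g s : R -> R).
Hypothesis Hs : nondecreasing s.
Hypotheses (Hf : continuity f) (Hg : continuity g).
Hypothesis f_le_g : forall x, Rabs (f x) <= g x.

Lemma RS_int_dominated_increment a b a' b' I J I' J' : a' <= a -> b <= b' ->
  RS_int f s a b I -> RS_int g s a b J -> RS_int f s a' b' I' -> RS_int g s a' b' J' ->
  Rabs (I' - I) <= J' - J.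
Proof.
  intros Ha Hb HI HJ HI' HJ'.
  assert (Mono : forall c, -1 <= c <= 1 -> 1 * J + c * I <= 1 * J' + c * I').
  { intros c Hc.
    apply (RS_int_interval_mono (fun x => 1 * g x + c * f x) s a b a' b');
      auto using RS_int_lin.
    - apply (continuity_plus (mult_real_fct 1 g) (mult_real_fct c f));
        apply continuity_scal; easy.
    - intros x. specialize (f_le_g x). apply Rabs_le_between in f_le_g. nra. }
  pose proof (Mono 1 ltac:(lra)). pose proof (Mono (-1) ltac:(lra)).
  apply Rabs_le. lra.
Qed.

Lemma RS_int_R_dominated J : RS_int_R g s J -> exists I, RS_int_R f s I.
Proof.
  rewrite RS_int_R_filterlim. intros [Hgval HJ].
  assert (Hfval : RS_integrable_on_segments f s).
  { intros a b Hab. destruct (RS_int_exists f s a b Hf Hs Hab) as [I HI].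
    apply RS_int_value with I; easy. }
  destruct (proj1 (filterlim_locally_cauchy (F := whole_line) (U := R_CompleteSpace)
    (fun ab => RS_value f s (fst ab) (snd ab)))) as [I HI];
    [|exists I; apply RS_int_R_filterlim; split; easy].
  intros eps. pose proof (cond_pos eps).
  rewrite (filterlim_locally_Rabs (F := whole_line)) in HJ.
  destruct (HJ (eps / 4) ltac:(lra)) as (M & HM & HJM).
  set (a := - M - 1). set (b := M + 1).
  assert (Near : forall a' b', a' < a -> b < b' ->
    Rabs (RS_value f s a' b' - RS_value f s a b) < eps / 2).
  { intros a' b' Ha Hb. unfold a, b in *.
    eapply Rle_lt_trans; [apply (RS_int_dominated_increment (- M - 1) (M + 1) a' b');
      try apply Hgval; try apply Hfval; lra|].
    pose proof (Rabs_def2 _ _ (HJM (- M - 1) (M + 1) ltac:(lra) ltac:(lra))).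
    pose proof (Rabs_def2 _ _ (HJM a' b' ltac:(lra) ltac:(lra))). simpl in *. lra. }
  exists (fun ab => fst ab < a /\ b < snd ab). split.
  - exists (M + 1). unfold a, b. simpl. split; [lra|]. intros; lra.
  - intros [a1 b1] [a2 b2] [Ha1 Hb1] [Ha2 Hb2]. simpl in *.
    pose proof (Rabs_def2 _ _ (Near a1 b1 Ha1 Hb1)).
    pose proof (Rabs_def2 _ _ (Near a2 b2 Ha2 Hb2)).
    change (Rabs (RS_value f s a2 b2 - RS_value f s a1 b1) < eps). apply Rabs_def1; lra.
Qed.

End Dominated.

(** * Positive functionals on functions of polynomial growth *)

Definition tempered (f : R -> Cx) : Prop :=
  (forall t, Cfilterlim f (locally t) (f t)) /\
  exists M m, forall t, Csqnorm (f t) <= M * (1 + t * t) ^ m.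

Lemma growth_constant_ge0 f M m :
  (forall t, Csqnorm (f t) <= M * (1 + t * t) ^ m) -> 0 <= M.
Proof.
  intros H. specialize (H 0). pose proof (Csqnorm_ge0 (f 0)).
  replace (1 + 0 * 0) with 1 in H by ring. rewrite pow1 in H. lra.
Qed.

Lemma tempered_bounded f M : (forall t, Cfilterlim f (locally t) (f t)) ->
  (forall t, Csqnorm (f t) <= M) -> tempered f.
Proof.
  intros Hf HM. split; [easy|]. exists M, O. intros t. simpl. rewrite Rmult_1_r. easy.
Qed.

Lemma tempered_const z : tempered (fun _ => z).
Proof.
  apply tempered_bounded with (Csqnorm z); [|intros; lra].
  intros t. apply Cfilterlim_const.
Qed.

Lemma tempered_add f g : tempered f -> tempered g -> tempered (fun t => f t + g t)%Cx.
Proof.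
  intros [Hf (M & m & HM)] [Hg (N & n & HN)]. split.
  - intros t. apply Cfilterlim_add; easy.
  - exists (2 * M + 2 * N), (m + n)%nat. intros t.
    assert (Raise : forall K i, 0 <= K -> (i <= m + n)%nat ->
      K * (1 + t * t) ^ i <= K * (1 + t * t) ^ (m + n))
      by (intros; apply Rmult_le_compat_l, Rle_pow; [easy|nra|easy]).
    pose proof (Raise M m (growth_constant_ge0 f M m HM) ltac:(lia)).
    pose proof (Raise N n (growth_constant_ge0 g N n HN) ltac:(lia)).
    pose proof (Csqnorm_add_le (f t) (g t)). specialize (HM t). specialize (HN t). lra.
Qed.

Lemma tempered_mul f g : tempered f -> tempered g -> tempered (fun t => f t * g t)%Cx.
Proof.
  intros [Hf (M & m & HM)] [Hg (N & n & HN)]. split.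
  - intros t. apply Cfilterlim_mul; easy.
  - exists (M * N), (m + n)%nat. intros t. rewrite Csqnorm_mul, pow_add.
    replace (M * N * ((1 + t * t) ^ m * (1 + t * t) ^ n))
      with (M * (1 + t * t) ^ m * (N * (1 + t * t) ^ n)) by ring.
    apply Rmult_le_compat; auto using Csqnorm_ge0.
Qed.

Lemma tempered_scal z f : tempered f -> tempered (fun t => z * f t)%Cx.
Proof. intros Hf. apply (tempered_mul (fun _ => z) f); [apply tempered_const|easy]. Qed.

Lemma tempered_lin a b f g : tempered f -> tempered g ->
  tempered (fun t => a * f t + b * g t)%Cx.
Proof. intros Hf Hg. apply tempered_add; apply tempered_scal; easy. Qed.

Lemma tempered_conj f : tempered f -> tempered (fun t => Cconj (f t)).
Proof.
  intros [Hf (M & m & HM)]. split.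
  - intros t. apply Cfilterlim_conj; easy.
  - exists M, m. intros t. rewrite Csqnorm_conj. easy.
Qed.

Lemma tempered_pow k : tempered (fun t => RtoC (t ^ k)).
Proof.
  induction k as [|k IH]; simpl; [apply tempered_const|].
  replace (fun t => RtoC (t * t ^ k)) with (fun t => RtoC t * RtoC (t ^ k))%Cx
    by (extensionality t; rewrite RtoC_mul; easy).
  apply tempered_mul; [|easy]. split.
  - intros t. split; [apply filterlim_id|exact (filterlim_const 0)].
  - exists 1, 1%nat. intros t. unfold Csqnorm. simpl. nra.
Qed.

Lemma tempered_csum n (f : nat -> R -> Cx) : (forall i, tempered (f i)) ->
  tempered (fun t => csum n (fun i => f i t)).
Proof.
  intros Hf. induction n as [|n IH]; simpl; [apply tempered_const|].
  apply tempered_add; easy.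
Qed.

Lemma tempered_comp_pow d f : tempered f -> tempered (fun t => f (t ^ d)).
Proof.
  intros [Hf (M & m & HM)]. split.
  - intros t. specialize (Hf (t ^ d)).
    pose proof (proj1 (proj1 (tempered_pow d) t)) as Hpow.
    split; [exact (filterlim_comp _ _ _ _ _ _ _ _ Hpow (proj1 Hf))
           |exact (filterlim_comp _ _ _ _ _ _ _ _ Hpow (proj2 Hf))].
  - exists (M * 2 ^ m), (d * m)%nat. intros t.
    eapply Rle_trans; [apply HM|]. rewrite Rmult_assoc.
    apply Rmult_le_compat_l; [apply (growth_constant_ge0 f M m HM)|].
    rewrite pow_mult, <- (Rpow_mult_distr t), <- (Rpow_mult_distr 2).
    pose proof (pow_le (t * t) d ltac:(nra)). apply pow_incr. split; [lra|].
    pose proof (pow_R1_Rle (1 + t * t) d ltac:(nra)).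
    pose proof (pow_incr (t * t) (1 + t * t) d ltac:(nra)). lra.
Qed.

Record positive_functional (L : (R -> Cx) -> Cx) : Prop := {
  functional_lin : forall a b f g, tempered f -> tempered g ->
    L (fun t => a * f t + b * g t)%Cx = (a * L f + b * L g)%Cx;
  functional_conj : forall f, tempered f -> L (fun t => Cconj (f t)) = Cconj (L f);
  functional_ge0 : forall f, tempered f -> (forall t, 0 <= Re (f t)) -> 0 <= Re (L f) }.

Definition has_moments (L : (R -> Cx) -> Cx) (m : nat -> R) : Prop :=
  forall k, L (fun t => RtoC (t ^ k)) = RtoC (m k).

Section PositiveFunctional.

Variable L : (R -> Cx) -> Cx.
Hypothesis HL : positive_functional L.

Lemma functional_ext f g : (forall t, f t = g t) -> L f = L g.
Proof. intros H. f_equal. extensionality t. apply H. Qed.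

Lemma functional_scal a f : tempered f -> L (fun t => a * f t)%Cx = (a * L f)%Cx.
Proof.
  intros Hf. transitivity (a * L f + C0 * L f)%Cx; [|ring].
  rewrite <- (functional_lin L HL) by easy. apply functional_ext; intros; ring.
Qed.

Lemma functional_csum n a (f : nat -> R -> Cx) : (forall i, tempered (f i)) ->
  L (fun t => csum n (fun i => a i * f i t))%Cx = csum n (fun i => a i * L (f i))%Cx.
Proof.
  intros Hf. induction n as [|n IH]; simpl.
  - transitivity (L (fun t => C0 * C0)%Cx); [apply functional_ext; intros; ring|].
    rewrite (functional_scal C0 (fun _ => C0)) by apply tempered_const. ring.
  - rewrite <- IH.
    transitivity (L (fun t => C1 * csum n (fun i => a i * f i t) + a n * f n t)%Cx).
    + apply functional_ext; intros; ring.
    + rewrite (functional_lin L HL); [ring| |easy].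
      apply (tempered_csum n (fun i t => a i * f i t)%Cx). intros; apply tempered_scal; easy.
Qed.

Lemma functional_le_total_mass f M : tempered f -> (forall t, Re (f t) <= M) ->
  Re (L f) <= M * Re (L (fun _ => C1)).
Proof.
  intros Hf HM.
  assert (H : 0 <= Re (L (fun t => RtoC M * C1 + - C1 * f t)%Cx)).
  { apply (functional_ge0 L HL); [apply tempered_lin; [apply tempered_const|easy]|].
    intros t. specialize (HM t). simpl. lra. }
  rewrite (functional_lin L HL) in H by (try apply tempered_const; easy). simpl in H. lra.
Qed.

End PositiveFunctional.

Definition power_pullback (d l : nat) (L : (R -> Cx) -> Cx) (f : R -> Cx) : Cx :=
  L (fun x => RtoC (x ^ l) * f (x ^ d)%R)%Cx.

Lemma tempered_power_pullback d l f : tempered f ->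
  tempered (fun x => RtoC (x ^ l) * f (x ^ d)%R)%Cx.
Proof. intros Hf. apply tempered_mul; [apply tempered_pow|apply tempered_comp_pow, Hf]. Qed.

Lemma power_pullback_positive d l L : Nat.even l = true ->
  positive_functional L -> positive_functional (power_pullback d l L).
Proof.
  intros Hl HL. unfold power_pullback. split.
  - intros a b f g Hf Hg.
    rewrite <- (functional_lin L HL) by (apply tempered_power_pullback; easy).
    apply functional_ext; intros; ring.
  - intros f Hf. rewrite <- (functional_conj L HL) by (apply tempered_power_pullback; easy).
    apply functional_ext; intros. rewrite Cconj_mul, Cconj_RtoC. easy.
  - intros f Hf Hp. apply (functional_ge0 L HL); [apply tempered_power_pullback; easy|].
    intros x. simpl. rewrite Rmult_0_l, Rminus_0_r. apply Rmult_le_pos; [|easy].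
    apply Nat.even_spec in Hl. destruct Hl as [m ->]. rewrite pow_mult.
    apply pow_le, pow2_ge_0.
Qed.

(** * The functional of a moment solution *)

Lemma CRS_int_R_unique f s I J : CRS_int_R f s I -> CRS_int_R f s J -> I = J.
Proof. intros [I1 I2] [J1 J2]. apply Cx_eq; eapply RS_int_R_unique; eassumption. Qed.

Lemma CRS_int_R_lin a b f g s I J : CRS_int_R f s I -> CRS_int_R g s J ->
  CRS_int_R (fun x => a * f x + b * g x)%Cx s (a * I + b * J)%Cx.
Proof.
  intros [I1 I2] [J1 J2].
  assert (Parts : forall p q p' q',
    RS_int_R (fun x => 1 * (p * Re (f x) + q * Im (f x)) + 1 * (p' * Re (g x) + q' * Im (g x))) s
      (1 * (p * Re I + q * Im I) + 1 * (p' * Re J + q' * Im J)))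
    by (intros; repeat apply RS_int_R_lin; easy).
  split.
  - replace (Re (a * I + b * J)) with (1 * (Re a * Re I + - Im a * Im I)
      + 1 * (Re b * Re J + - Im b * Im J)) by (simpl; ring).
    eapply RS_int_R_ext; [|apply Parts]. intros; simpl; ring.
  - replace (Im (a * I + b * J)) with (1 * (Im a * Re I + Re a * Im I)
      + 1 * (Im b * Re J + Re b * Im J)) by (simpl; ring).
    eapply RS_int_R_ext; [|apply Parts]. intros; simpl; ring.
Qed.

Lemma CRS_int_R_RtoC f s I : RS_int_R f s I -> CRS_int_R (fun x => RtoC (f x)) s (RtoC I).
Proof.
  intros HI. split; simpl; [easy|]. replace 0 with (0 * I + 0 * I) by ring.
  eapply RS_int_R_ext; [|apply RS_int_R_lin; exact HI]. intros; simpl; ring.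
Qed.

Definition stieltjes (s : R -> R) (f : R -> Cx) : Cx :=
  mkC (@iota R_CompleteSpace (RS_int_R (fun x => Re (f x)) s))
      (@iota R_CompleteSpace (RS_int_R (fun x => Im (f x)) s)).

Lemma stieltjes_int f s I : CRS_int_R f s I -> CRS_int_R f s (stieltjes s f).
Proof.
  intros [I1 I2].
  split; refine (@iota_correct R_AbsRing R_CompleteNormedModule (RS_int_R _ _) _);
    eexists; (split; [eassumption|]); intros J; apply RS_int_R_unique; eassumption.
Qed.

Lemma stieltjes_unique f s I : CRS_int_R f s I -> stieltjes s f = I.
Proof.
  intros HI. apply (CRS_int_R_unique f s); [|easy]. apply stieltjes_int with I; easy.
Qed.

Section MomentSolution.

Variables (m : nat -> R) (s : R -> R).
Hypothesis Hs : moment_solution m s.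

Lemma RS_int_R_weighted_moment n k :
  exists I, RS_int_R (fun x => x ^ k * (1 + x * x) ^ n) s I.
Proof.
  revert k. induction n as [|n IH]; intros k.
  - exists (m k). apply RS_int_R_ext with (fun x => x ^ k); [intros; simpl; ring|].
    apply Hs.
  - destruct (IH k) as [I HI], (IH (S (S k))) as [J HJ]. exists (1 * I + 1 * J).
    eapply RS_int_R_ext; [|apply RS_int_R_lin; [exact HI|exact HJ]]. intros x. simpl. ring.
Qed.

Lemma RS_int_R_exists f M n : continuity f ->
  (forall x, f x * f x <= M * (1 + x * x) ^ n) -> exists I, RS_int_R f s I.
Proof.
  intros Hf HM. destruct (RS_int_R_weighted_moment n 0) as [I HI].
  destruct (RS_int_R_weighted_moment 0 0) as [J HJ].
  apply (RS_int_R_dominated f (fun x => M * (1 + x * x) ^ n + 1) s) with (M * I + 1 * J).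
  - apply Hs.
  - easy.
  - reg.
  - intros x. specialize (HM x). apply Rabs_le. nra.
  - eapply RS_int_R_ext; [|apply RS_int_R_lin; [exact HI|exact HJ]]. intros x. simpl. ring.
Qed.

Lemma stieltjes_correct f : tempered f -> CRS_int_R f s (stieltjes s f).
Proof.
  intros [Hf (M & n & HM)].
  destruct (RS_int_R_exists (fun x => Re (f x)) M n) as [I HI].
  { intros x. apply continuity_pt_filterlim, Hf. }
  { intros x. eapply Rle_trans; [apply Re_sqr_le_Csqnorm|easy]. }
  destruct (RS_int_R_exists (fun x => Im (f x)) M n) as [J HJ].
  { intros x. apply continuity_pt_filterlim, Hf. }
  { intros x. eapply Rle_trans; [apply Im_sqr_le_Csqnorm|easy]. }
  apply stieltjes_int with (mkC I J). split; easy.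
Qed.

Lemma stieltjes_positive : positive_functional (stieltjes s).
Proof.
  split.
  - intros a b f g Hf Hg. apply stieltjes_unique, CRS_int_R_lin; apply stieltjes_correct; easy.
  - intros f Hf. destruct (stieltjes_correct f Hf) as [HRe HIm].
    apply stieltjes_unique. split; simpl; [easy|].
    replace (- iota _) with (-1 * Im (stieltjes s f) + 0 * Im (stieltjes s f)) by (simpl; ring).
    eapply RS_int_R_ext; [|apply RS_int_R_lin; exact HIm]. intros; simpl; ring.
  - intros f Hf Hp. apply (RS_int_R_ge0 (fun x => Re (f x)) s); [apply Hs|easy|].
    apply stieltjes_correct; easy.
Qed.

Lemma stieltjes_moments : has_moments (stieltjes s) m.
Proof. intros k. apply stieltjes_unique, CRS_int_R_RtoC, Hs. Qed.

Lemma power_pullback_moments d l :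
  has_moments (power_pullback d l (stieltjes s)) (fun k => m (k * d + l)%nat).
Proof.
  intros k. rewrite <- stieltjes_moments. unfold power_pullback. apply functional_ext. intros x.
  rewrite <- RtoC_mul, pow_add, Nat.mul_comm, pow_mult. f_equal. ring.
Qed.

End MomentSolution.

(** * Semi-inner products and Bessel residuals *)

Record semi_inner {T : Type} (V : (T -> Cx) -> Prop) (B : (T -> Cx) -> (T -> Cx) -> Cx) : Prop := {
  semi_inner_lin : forall a b f g h, V f -> V g -> V h ->
    B (fun t => a * f t + b * g t)%Cx h = (a * B f h + b * B g h)%Cx;
  semi_inner_conj : forall f g, V f -> V g -> B g f = Cconj (B f g);
  semi_inner_ge0 : forall f, V f -> 0 <= Re (B f f) }.

Lemma le_mul_of_quadratic_ge0 X Y n : 0 <= X -> 0 <= Y -> 0 <= n ->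
  (forall s, 0 <= X - 2 * s * n + s * s * n * Y) -> n <= X * Y.
Proof.
  intros HX HY Hn H. destruct HY as [HY|<-].
  - specialize (H (/ Y)).
    replace (X - 2 * / Y * n + / Y * / Y * n * Y) with (X - n * / Y) in H by (field; lra).
    apply Rmult_le_reg_r with (/ Y); [apply Rinv_0_lt_compat; easy|].
    replace (X * Y * / Y) with X by (field; lra). lra.
  - destruct Hn as [Hn|<-]; [|lra]. specialize (H ((X + 1) / (2 * n))).
    replace (X - 2 * ((X + 1) / (2 * n)) * n + (X + 1) / (2 * n) * ((X + 1) / (2 * n)) * n * 0)
      with (-1) in H by (field; lra). lra.
Qed.

Section SemiInner.

Context {T : Type} (V : (T -> Cx) -> Prop).
Hypothesis V_lin : forall a b f g, V f -> V g -> V (fun t => a * f t + b * g t)%Cx.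

Section Form.

Variable B : (T -> Cx) -> (T -> Cx) -> Cx.
Hypothesis HB : semi_inner V B.

Lemma semi_inner_lin_r a b f g h : V f -> V g -> V h ->
  B h (fun t => a * f t + b * g t)%Cx = (Cconj a * B h f + Cconj b * B h g)%Cx.
Proof.
  intros Hf Hg Hh. rewrite (semi_inner_conj _ _ HB _ h) by auto.
  rewrite (semi_inner_lin _ _ HB), Cconj_add, !Cconj_mul by easy.
  rewrite <- !(semi_inner_conj _ _ HB) by easy. easy.
Qed.

Lemma semi_inner_self f : V f -> B f f = RtoC (Re (B f f)).
Proof.
  intros Hf. pose proof (f_equal Im (semi_inner_conj _ _ HB f f Hf Hf)) as H. simpl in H.
  apply Cx_eq; simpl; lra.
Qed.

Lemma semi_inner_expand a b f g : V f -> V g ->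
  Re (B (fun t => a * f t + b * g t)%Cx (fun t => a * f t + b * g t)%Cx) =
  Csqnorm a * Re (B f f) + 2 * Re (a * Cconj b * B f g) + Csqnorm b * Re (B g g).
Proof.
  intros Hf Hg. rewrite (semi_inner_lin _ _ HB), !semi_inner_lin_r by auto.
  rewrite (semi_inner_conj _ _ HB f g) by easy.
  rewrite (semi_inner_self f), (semi_inner_self g) by easy.
  unfold Csqnorm. simpl. ring.
Qed.

Lemma semi_inner_cauchy_schwarz f g : V f -> V g ->
  Csqnorm (B f g) <= Re (B f f) * Re (B g g).
Proof.
  intros Hf Hg.
  apply le_mul_of_quadratic_ge0; try (apply (semi_inner_ge0 _ _ HB); easy);
    [apply Csqnorm_ge0|].
  intros s. pose proof (semi_inner_expand C1 (RtoC (- s) * B f g) f g Hf Hg) as H.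
  pose proof (semi_inner_ge0 _ _ HB _ (V_lin C1 (RtoC (- s) * B f g) f g Hf Hg)) as Hp.
  rewrite H in Hp. unfold Csqnorm in *. simpl in Hp. nra.
Qed.

Lemma semi_inner_deflate e : V e -> B e e = C1 ->
  semi_inner V (fun f g => B f g - B f e * Cconj (B g e))%Cx.
Proof.
  intros He Hee. split.
  - intros a b f g h Hf Hg Hh. rewrite !(semi_inner_lin _ _ HB) by easy. ring.
  - intros f g Hf Hg. rewrite (semi_inner_conj _ _ HB f g) by easy.
    rewrite Cconj_sub, Cconj_mul, Cconj_involutive. ring.
  - intros f Hf. rewrite Cmul_conj. simpl.
    pose proof (semi_inner_cauchy_schwarz f e Hf He) as H. rewrite Hee in H. simpl in H. lra.
Qed.

End Form.

Variables (B : (T -> Cx) -> (T -> Cx) -> Cx) (e : nat -> T -> Cx).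
Hypothesis HB : semi_inner V B.
Hypothesis e_in_V : forall k, V (e k).
Hypothesis e_orthonormal : forall j k, B (e j) (e k) = kronecker j k.

Definition residual (n : nat) (f g : T -> Cx) : Cx :=
  (B f g - csum n (fun k => B f (e k) * Cconj (B g (e k))))%Cx.

Lemma residual_basis n k f : (n <= k)%nat -> residual n f (e k) = B f (e k).
Proof.
  intros Hnk. unfold residual. rewrite csum_zero; [ring|]. intros j Hj.
  rewrite e_orthonormal, kronecker_neq, Cconj_C0 by lia. ring.
Qed.

Lemma residual_S n f g :
  residual (S n) f g = (residual n f g - residual n f (e n) * Cconj (residual n g (e n)))%Cx.
Proof. rewrite !residual_basis by easy. unfold residual. simpl. ring. Qed.

Lemma residual_semi_inner n : semi_inner V (residual n).
Proof.
  induction n as [|n IH].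
  - replace (residual 0) with B; [easy|]. extensionality f. extensionality g.
    unfold residual. simpl. ring.
  - replace (residual (S n))
      with (fun f g => residual n f g - residual n f (e n) * Cconj (residual n g (e n)))%Cx
      by (extensionality f; extensionality g; symmetry; apply residual_S).
    apply semi_inner_deflate; auto.
    rewrite residual_basis, e_orthonormal, kronecker_diag by easy. easy.
Qed.

Lemma residual_norm_decreasing n f :
  Re (residual (S n) f f) <= Re (residual n f f).
Proof.
  rewrite residual_S, Cmul_conj. simpl. pose proof (Csqnorm_ge0 (residual n f (e n))). lra.
Qed.

Lemma residual_norm_cv f : V f ->
  exists l, filterlim (fun n => Re (residual n f f)) eventually (locally l).
Proof.
  intros Hf. apply (ex_finite_lim_seq_decr _ 0).
  - intros n. apply residual_norm_decreasing.
  - intros n. apply (semi_inner_ge0 _ _ (residual_semi_inner n)). easy.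
Qed.

Lemma residual_Re_cv f g : V f -> V g ->
  exists l, filterlim (fun n => Re (residual n f g)) eventually (locally l).
Proof.
  intros Hf Hg.
  destruct (residual_norm_cv f Hf) as [lf Hlf], (residual_norm_cv g Hg) as [lg Hlg].
  destruct (residual_norm_cv _ (V_lin C1 C1 f g Hf Hg)) as [l Hl].
  exists (/ 2 * (l - lf - lg)).
  apply (filterlim_ext (fun n => / 2 * (Re (residual n (fun t => C1 * f t + C1 * g t)%Cx
    (fun t => C1 * f t + C1 * g t)%Cx) - Re (residual n f f) - Re (residual n g g)))).
  - intros n. rewrite (semi_inner_expand _ (residual_semi_inner n)) by easy.
    unfold Csqnorm. simpl. field.
  - apply filterlim_Rmult; [apply filterlim_const|]. repeat apply filterlim_Rminus; easy.
Qed.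

Definition residual_lim (f g : T -> Cx) : Cx :=
  mkC (Lim_seq (fun n => Re (residual n f g))) (Lim_seq (fun n => Im (residual n f g))).

Lemma residual_cv f g : V f -> V g ->
  Cfilterlim (fun n => residual n f g) eventually (residual_lim f g).
Proof.
  intros Hf Hg. split; apply (Lim_seq_correct' (fun n => _)).
  - apply residual_Re_cv; easy.
  - destruct (residual_Re_cv f _ Hf (V_lin (mkC 0 1) C0 g g Hg Hg)) as [l Hl]. exists l.
    revert Hl. apply filterlim_ext. intros n.
    rewrite (semi_inner_lin_r _ (residual_semi_inner n)) by easy. simpl. ring.
Qed.

Lemma residual_lim_semi_inner : semi_inner V residual_lim.
Proof.
  split.
  - intros a b f g h Hf Hg Hh.
    apply (Cfilterlim_unique (F := eventually)
      (fun n => residual n (fun t => a * f t + b * g t)%Cx h)); [apply residual_cv; auto|].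
    apply (Cfilterlim_ext (fun n => a * residual n f h + b * residual n g h)%Cx).
    + intros n. symmetry. apply (semi_inner_lin _ _ (residual_semi_inner n)); easy.
    + apply Cfilterlim_add; (apply Cfilterlim_mul; [apply Cfilterlim_const|]);
        apply residual_cv; easy.
  - intros f g Hf Hg.
    apply (Cfilterlim_unique (F := eventually) (fun n => residual n g f));
      [apply residual_cv; easy|].
    apply (Cfilterlim_ext (fun n => Cconj (residual n f g))).
    + intros n. symmetry. apply (semi_inner_conj _ _ (residual_semi_inner n)); easy.
    + apply Cfilterlim_conj, residual_cv; easy.
  - intros f Hf. apply (filterlim_Rle (F := eventually) (fun _ => 0)
      (fun n => Re (residual n f f)));
      [|apply filterlim_const|exact (proj1 (residual_cv f f Hf Hf))].
    intros n. apply (semi_inner_ge0 _ _ (residual_semi_inner n)). easy.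
Qed.

Lemma residual_lim_le f : V f -> Re (residual_lim f f) <= Re (B f f).
Proof.
  intros Hf. apply (filterlim_Rle (F := eventually) (fun n => Re (residual n f f))
    (fun _ => Re (B f f)));
    [|exact (proj1 (residual_cv f f Hf Hf))|apply filterlim_const].
  intros n. induction n as [|n IH]; [unfold residual; simpl; lra|].
  eapply Rle_trans; [apply residual_norm_decreasing|exact IH].
Qed.

End SemiInner.

(** * Orthonormal polynomials *)

Section OrthonormalPolynomials.

Variables (m : nat -> R) (P : nat -> nat -> R).

(* The linear functional [x ^ j |-> lam j] applied to the polynomial [P k]. *)
Definition pairing (k : nat) (lam : nat -> Cx) : Cx :=
  csum (S k) (fun j => RtoC (P k j) * lam j)%Cx.

Definition moment_orthonormal : Prop := forall k l,
  pairing k (fun i => pairing l (fun j => RtoC (m (i + j)))) = kronecker k l.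

Lemma pairing_ext k lam lam' : (forall j, lam j = lam' j) -> pairing k lam = pairing k lam'.
Proof. intros H. apply csum_ext. intros j _. rewrite H. easy. Qed.

Lemma pairing_lin k a b lam lam' :
  pairing k (fun j => a * lam j + b * lam' j)%Cx = (a * pairing k lam + b * pairing k lam')%Cx.
Proof. unfold pairing. rewrite <- csum_lin. apply csum_ext; intros; ring. Qed.

Lemma pairing_scal k a lam : pairing k (fun j => a * lam j)%Cx = (a * pairing k lam)%Cx.
Proof. unfold pairing. rewrite <- csum_scal. apply csum_ext; intros; ring. Qed.

Lemma pairing_swap k l (f : nat -> nat -> Cx) :
  pairing k (fun i => pairing l (f i)) = pairing l (fun j => pairing k (fun i => f i j)).
Proof.
  unfold pairing.
  transitivity (csum (S k) (fun i => csum (S l)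
    (fun j => RtoC (P k i) * (RtoC (P l j) * f i j)))%Cx).
  - apply csum_ext. intros i _. rewrite csum_scal. easy.
  - rewrite csum_swap. apply csum_ext. intros j _. rewrite <- csum_scal.
    apply csum_ext; intros; ring.
Qed.

Lemma pairing_0 lam : pairing 0 lam = (RtoC (P 0%nat 0%nat) * lam O)%Cx.
Proof. unfold pairing. simpl. ring. Qed.

Lemma Cconj_pairing k lam : Cconj (pairing k lam) = pairing k (fun j => Cconj (lam j)).
Proof.
  unfold pairing. rewrite Cconj_csum. apply csum_ext; intros.
  rewrite Cconj_mul, Cconj_RtoC. easy.
Qed.

Lemma Cconj_pevalC k z : Cconj (pevalC (P k) k z) = pevalC (P k) k (Cconj z).
Proof.
  change (pevalC (P k) k z) with (pairing k (Cpow z)). rewrite Cconj_pairing.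
  apply pairing_ext. intros j. apply Cconj_pow.
Qed.

Hypothesis P_lead : forall k, 0 < P k k.
Hypothesis P_orthonormal : moment_orthonormal.

Definition expands_to (n : nat) (U : (nat -> Cx) -> Cx) : Prop :=
  exists c, forall lam, U lam = csum n (fun j => c j * pairing j lam)%Cx.

Lemma expands_to_lin n a b U U' : expands_to n U -> expands_to n U' ->
  expands_to n (fun lam => a * U lam + b * U' lam)%Cx.
Proof.
  intros [c Hc] [c' Hc']. exists (fun j => a * c j + b * c' j)%Cx. intros lam.
  rewrite Hc, Hc', <- csum_lin. apply csum_ext; intros; ring.
Qed.

Lemma expands_to_csum n l a (U : nat -> (nat -> Cx) -> Cx) :
  (forall i, (i < l)%nat -> expands_to n (U i)) ->
  expands_to n (fun lam => csum l (fun i => a i * U i lam))%Cx.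
Proof.
  induction l as [|l IH]; intros HU.
  - exists (fun _ => C0). intros lam. rewrite csum_scal. simpl. ring.
  - destruct (expands_to_lin n C1 (a l) _ _ (IH (fun i Hi => HU i (Nat.lt_lt_succ_r i l Hi)))
      (HU l (Nat.lt_succ_diag_r l))) as [c Hc].
    exists c. intros lam. rewrite <- Hc. simpl. ring.
Qed.

Lemma expands_to_pairing n k : (k < n)%nat -> expands_to n (pairing k).
Proof.
  intros Hk. exists (fun j => kronecker j k). intros lam.
  rewrite <- (csum_kronecker n k (fun j => pairing j lam) Hk). apply csum_ext; intros; ring.
Qed.

Lemma expands_to_eval n k : (k < n)%nat -> expands_to n (fun lam => lam k).
Proof.
  induction k as [k IH] using (well_founded_induction Wf_nat.lt_wf). intros Hk.
  assert (Low : expands_to n (fun lam => csum k (fun j => RtoC (P k j) * lam j))%Cx).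
  { apply (expands_to_csum n k _ (fun j lam => lam j)). intros; apply IH; lia. }
  destruct (expands_to_lin n (RtoC (/ P k k)) (- RtoC (/ P k k)) _ _
    (expands_to_pairing n k Hk) Low) as [c Hc].
  exists c. intros lam. rewrite <- Hc. unfold pairing. simpl csum.
  transitivity (RtoC (/ P k k) * RtoC (P k k) * lam k)%Cx; [|ring].
  pose proof (P_lead k). rewrite <- RtoC_mul, Rinv_l by lra. apply Cx_eq; simpl; ring.
Qed.

(* The matrix of multiplication by [x] in the orthonormal basis. *)
Definition jacobi (k l : nat) : Cx :=
  pairing k (fun i => pairing l (fun j => RtoC (m (S i + j)))).

Lemma jacobi_sym k l : jacobi k l = jacobi l k.
Proof.
  unfold jacobi. rewrite pairing_swap. apply pairing_ext. intros j.
  apply pairing_ext. intros i. do 2 f_equal. lia.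
Qed.

Lemma pairing_shift lam k n : (S k < n)%nat ->
  pairing k (fun j => lam (S j)) = csum n (fun j => jacobi k j * pairing j lam)%Cx.
Proof.
  intros Hk.
  destruct (expands_to_csum n (S k) (fun j => RtoC (P k j)) (fun j mu => mu (S j)))
    as [c Hc]; [intros i Hi; apply (expands_to_eval n (S i)); lia|].
  change (forall mu, pairing k (fun j => mu (S j)) =
    csum n (fun j => c j * pairing j mu)%Cx) in Hc.
  rewrite Hc. apply csum_ext. intros l Hl. f_equal. unfold jacobi.
  rewrite (Hc (fun i => pairing l (fun j => RtoC (m (i + j))))).
  rewrite <- (csum_kronecker n l c Hl). apply csum_ext. intros i _.
  rewrite P_orthonormal. easy.
Qed.

Lemma jacobi_band k l : (S k < l)%nat -> jacobi k l = C0.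
Proof.
  intros Hl. unfold jacobi.
  rewrite (pairing_shift (fun i => pairing l (fun j => RtoC (m (i + j)))) k (S (S k)))
    by lia.
  apply csum_zero. intros j Hj. rewrite P_orthonormal, kronecker_neq by lia. ring.
Qed.

Definition jacobi_solution (z tau : Cx) (u : nat -> Cx) : Prop :=
  forall k n, (S k < n)%nat ->
    (z * u k + kronecker k 0 * tau)%Cx = csum n (fun j => jacobi k j * u j)%Cx.

Lemma jacobi_solution_pairing z r lam :
  (forall j, lam (S j) = (z * lam j + r * RtoC (m j))%Cx) ->
  jacobi_solution z (r * RtoC (/ P O O))%Cx (fun k => pairing k lam).
Proof.
  intros Hlam k n Hk. rewrite <- pairing_shift by easy. pose proof (P_lead 0).
  rewrite (pairing_ext _ _ _ Hlam), pairing_lin. f_equal.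
  transitivity (r * (RtoC (/ P 0%nat 0%nat) *
    pairing k (fun i => pairing 0 (fun j => RtoC (m (i + j))))))%Cx.
  - rewrite P_orthonormal. ring.
  - f_equal. rewrite <- pairing_scal. apply pairing_ext. intros i.
    rewrite pairing_0, Nat.add_0_r, <- !RtoC_mul. f_equal. field. lra.
Qed.

Lemma jacobi_quadratic z tau u v n : jacobi_solution z tau u ->
  (z * csum (S n) (fun k => u k * v k) + tau * v O =
   csum (S n) (fun k => csum (S n) (fun j => v k * (jacobi k j * u j)))
   + jacobi n (S n) * u (S n) * v n)%Cx.
Proof.
  intros Hu.
  transitivity (csum (S n) (fun k => v k * csum (S (S n)) (fun j => jacobi k j * u j)))%Cx.
  - symmetry.
    rewrite (csum_ext (S n) _ (fun k => z * (u k * v k) + C1 * (tau * v k * kronecker k 0))%Cx).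
    + rewrite csum_lin, (csum_kronecker _ _ (fun k => tau * v k)%Cx) by lia. ring.
    + intros k Hk. rewrite <- Hu by lia. ring.
  - rewrite (csum_ext (S n) _ (fun k => csum (S n) (fun j => v k * (jacobi k j * u j))
      + (jacobi n (S n) * u (S n) * v k) * kronecker k n)%Cx).
    + rewrite csum_plus, (csum_kronecker _ _ (fun k => jacobi n (S n) * u (S n) * v k)%Cx)
        by lia. easy.
    + intros k Hk. rewrite csum_scal.
      change (csum (S (S n)) (fun j => jacobi k j * u j)%Cx)
        with (csum (S n) (fun j => jacobi k j * u j) + jacobi k (S n) * u (S n))%Cx.
      destruct (Nat.eq_dec k n) as [->|Hkn].
      * rewrite kronecker_diag. ring.
      * rewrite jacobi_band, kronecker_neq by lia. ring.
Qed.

Lemma jacobi_green z y tu tv u v n : jacobi_solution z tu u -> jacobi_solution y tv v ->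
  (jacobi n (S n) * (u (S n) * v n - u n * v (S n)) =
   (z - y) * csum (S n) (fun k => u k * v k) + (tu * v O - tv * u O))%Cx.
Proof.
  intros Hu Hv.
  pose proof (jacobi_quadratic z tu u v n Hu) as Eu.
  pose proof (jacobi_quadratic y tv v u n Hv) as Ev.
  rewrite csum_swap in Ev.
  rewrite (csum_ext _ (fun j => csum (S n) (fun i => u i * (jacobi i j * v j)))%Cx
    (fun k => csum (S n) (fun j => v k * (jacobi k j * u j)))%Cx) in Ev.
  - rewrite (csum_ext _ (fun k => v k * u k)%Cx (fun k => u k * v k)%Cx) in Ev
      by (intros; ring).
    transitivity ((z * csum (S n) (fun k => u k * v k) + tu * v O)
      - (y * csum (S n) (fun k => u k * v k) + tv * u O))%Cx; [|ring].
    rewrite Eu, Ev. ring.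
  - intros k _. apply csum_ext. intros j _. rewrite (jacobi_sym j k). ring.
Qed.

(** * Christoffel-Darboux identity *)

(* The moments of [1 / (t - z)] when its integral is [w]. *)
Fixpoint cauchy_moments (w z : Cx) (j : nat) : Cx :=
  match j with
  | O => w
  | S j => (z * cauchy_moments w z j + RtoC (m j))%Cx
  end.

Lemma Cconj_cauchy_moments w z j :
  Cconj (cauchy_moments w z j) = cauchy_moments (Cconj w) (Cconj z) j.
Proof.
  induction j as [|j IH]; simpl; [easy|].
  rewrite Cconj_add, Cconj_mul, IH, Cconj_RtoC. easy.
Qed.

Lemma cauchy_moments_split w z j :
  cauchy_moments w z j = (w * Cpow z j + C1 * cauchy_moments C0 z j)%Cx.
Proof. induction j as [|j IH]; simpl; [ring|rewrite IH; ring]. Qed.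

Lemma cauchy_moments_csum z j :
  cauchy_moments C0 z j = csum j (fun i => Cpow z i * RtoC (m (j - 1 - i)))%Cx.
Proof.
  induction j as [|j IH]; [easy|]. rewrite csum_shift. simpl cauchy_moments.
  rewrite IH, <- csum_scal.
  rewrite (csum_ext j (fun i => Cpow z (S i) * RtoC (m (S j - 1 - S i)))%Cx
    (fun i => z * (Cpow z i * RtoC (m (j - 1 - i))))%Cx).
  - replace (S j - 1 - 0)%nat with j by lia. simpl. ring.
  - intros i Hi. replace (S j - 1 - S i)%nat with (j - 1 - i)%nat by lia. simpl. ring.
Qed.

Definition cauchy_coef (w z : Cx) (k : nat) : Cx := pairing k (cauchy_moments w z).

Lemma cauchy_coef_split w z k :
  cauchy_coef w z k = (w * pevalC (P k) k z + cauchy_coef C0 z k)%Cx.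
Proof.
  unfold cauchy_coef. rewrite (pairing_ext _ _ _ (cauchy_moments_split w z)), pairing_lin.
  unfold pairing, pevalC. ring.
Qed.

Lemma cauchy_coef_0 w z : cauchy_coef w z 0 = (RtoC (P 0%nat 0%nat) * w)%Cx.
Proof. apply pairing_0. Qed.

Lemma Cconj_cauchy_coef w z k :
  Cconj (cauchy_coef w z k) = cauchy_coef (Cconj w) (Cconj z) k.
Proof.
  unfold cauchy_coef. rewrite Cconj_pairing. apply pairing_ext, Cconj_cauchy_moments.
Qed.

Lemma jacobi_solution_pevalC z : jacobi_solution z C0 (fun k => pevalC (P k) k z).
Proof.
  replace C0 with (C0 * RtoC (/ P 0%nat 0%nat))%Cx by ring.
  apply (jacobi_solution_pairing z C0 (Cpow z)). intros j. simpl. ring.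
Qed.

Lemma jacobi_solution_cauchy_coef w z :
  jacobi_solution z (RtoC (/ P O O)) (cauchy_coef w z).
Proof.
  replace (RtoC (/ P 0%nat 0%nat)) with (C1 * RtoC (/ P 0%nat 0%nat))%Cx by ring.
  apply (jacobi_solution_pairing z C1 (cauchy_moments w z)). intros j. simpl. ring.
Qed.

Definition numerator_sum (w z : Cx) (n : nat) : Cx :=
  (C1 + z * csum (S n) (fun k => cauchy_coef w z k * pevalC (P k) k C0))%Cx.

Definition denominator_sum (w z : Cx) (n : nat) : Cx :=
  (- w + z * csum (S n) (fun k => cauchy_coef w z k * cauchy_coef C0 C0 k))%Cx.

Lemma lead_inv_mul z : (RtoC (/ P O O) * (RtoC (P O O) * z))%Cx = z.
Proof.
  pose proof (P_lead 0). transitivity (RtoC (/ P O O * P O O) * z)%Cx.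
  - rewrite RtoC_mul. ring.
  - rewrite Rinv_l by lra. change (RtoC 1) with C1. ring.
Qed.

Lemma pevalC_0 z : pevalC (P 0%nat) 0 z = (RtoC (P 0%nat 0%nat) * C1)%Cx.
Proof. apply (pairing_0 (Cpow z)). Qed.

Lemma numerator_sum_green w z n :
  (numerator_sum w z n = jacobi n (S n) *
    (cauchy_coef w z (S n) * pevalC (P n) n C0
     - cauchy_coef w z n * pevalC (P (S n)) (S n) C0))%Cx.
Proof.
  rewrite (jacobi_green z C0 _ _ _ _ n (jacobi_solution_cauchy_coef w z)
    (jacobi_solution_pevalC C0)).
  rewrite pevalC_0, lead_inv_mul. unfold numerator_sum. ring.
Qed.

Lemma denominator_sum_green w z n :
  (denominator_sum w z n = jacobi n (S n) *
    (cauchy_coef w z (S n) * cauchy_coef C0 C0 n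
     - cauchy_coef w z n * cauchy_coef C0 C0 (S n)))%Cx.
Proof.
  rewrite (jacobi_green z C0 _ _ _ _ n (jacobi_solution_cauchy_coef w z)
    (jacobi_solution_cauchy_coef C0 C0)).
  rewrite !cauchy_coef_0, !lead_inv_mul. unfold denominator_sum. ring.
Qed.

Lemma casorati_pevalC_cauchy_coef n :
  (jacobi n (S n) * (pevalC (P (S n)) (S n) C0 * cauchy_coef C0 C0 n
    - pevalC (P n) n C0 * cauchy_coef C0 C0 (S n)) = - C1)%Cx.
Proof.
  rewrite (jacobi_green C0 C0 _ _ _ _ n (jacobi_solution_pevalC C0)
    (jacobi_solution_cauchy_coef C0 C0)).
  rewrite pevalC_0, lead_inv_mul. ring.
Qed.

Lemma christoffel_darboux w z v y n :
  (numerator_sum w z n * denominator_sum v y n - denominator_sum w z n * numerator_sum v y n =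
   (w - v) - (z - y) * csum (S n) (fun k => cauchy_coef w z k * cauchy_coef v y k))%Cx.
Proof.
  pose proof (jacobi_green z y _ _ _ _ n (jacobi_solution_cauchy_coef w z)
    (jacobi_solution_cauchy_coef v y)) as G.
  rewrite !cauchy_coef_0, !lead_inv_mul in G.
  rewrite !numerator_sum_green, !denominator_sum_green.
  transitivity ((jacobi n (S n) * (pevalC (P (S n)) (S n) C0 * cauchy_coef C0 C0 n
      - pevalC (P n) n C0 * cauchy_coef C0 C0 (S n))) *
    (jacobi n (S n) * (cauchy_coef w z (S n) * cauchy_coef v y n
      - cauchy_coef w z n * cauchy_coef v y (S n))))%Cx; [ring|].
  rewrite casorati_pevalC_cauchy_coef, G. ring.
Qed.

Lemma Cconj_numerator_sum w z n :
  Cconj (numerator_sum w z n) = numerator_sum (Cconj w) (Cconj z) n.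
Proof.
  unfold numerator_sum. rewrite Cconj_add, Cconj_mul, Cconj_csum, Cconj_C1.
  do 2 f_equal. apply csum_ext. intros k _.
  rewrite Cconj_mul, Cconj_cauchy_coef, Cconj_pevalC, Cconj_C0. easy.
Qed.

Lemma Cconj_denominator_sum w z n :
  Cconj (denominator_sum w z n) = denominator_sum (Cconj w) (Cconj z) n.
Proof.
  unfold denominator_sum. rewrite Cconj_add, Cconj_mul, Cconj_csum, Cconj_opp.
  do 2 f_equal. apply csum_ext. intros k _.
  rewrite Cconj_mul, !Cconj_cauchy_coef, Cconj_C0. easy.
Qed.

End OrthonormalPolynomials.

(** * The Cauchy kernel *)

Definition cauchy_kernel (z : Cx) (t : R) : Cx := Cinv (RtoC t - z)%Cx.

Lemma RtoC_sub_neq0 z t : Im z <> 0 -> (RtoC t - z)%Cx <> C0.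
Proof. intros Hz H. apply (f_equal Im) in H. simpl in H. lra. Qed.

Lemma Im_sqr_gt0 z : Im z <> 0 -> 0 < Im z * Im z.
Proof. exact (Rsqr_pos_lt (Im z)). Qed.

Lemma Csqnorm_cauchy_kernel_le z t : Im z <> 0 ->
  Csqnorm (cauchy_kernel z t) <= / (Im z * Im z).
Proof.
  intros Hz. unfold cauchy_kernel. rewrite Csqnorm_inv by (apply RtoC_sub_neq0; easy).
  apply Rinv_le_contravar; [apply Im_sqr_gt0; easy|].
  eapply Rle_trans; [|apply Im_sqr_le_Csqnorm]. simpl. lra.
Qed.

Lemma cauchy_kernel_tempered z : Im z <> 0 -> tempered (cauchy_kernel z).
Proof.
  intros Hz. apply tempered_bounded with (/ (Im z * Im z)).
  - intros t. apply Cfilterlim_inv; [apply RtoC_sub_neq0; easy|].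
    apply Cfilterlim_sub; [split; [apply filterlim_id|exact (filterlim_const 0)]|].
    apply Cfilterlim_const.
  - intros t. apply Csqnorm_cauchy_kernel_le; easy.
Qed.

Lemma Cconj_cauchy_kernel z t : Cconj (cauchy_kernel z t) = cauchy_kernel (Cconj z) t.
Proof. unfold cauchy_kernel. rewrite Cconj_inv, Cconj_sub, Cconj_RtoC. easy. Qed.

Lemma cauchy_kernel_resolvent z y t : Im z <> 0 -> Im y <> 0 ->
  (cauchy_kernel z t - cauchy_kernel y t =
   (z - y) * (cauchy_kernel z t * cauchy_kernel y t))%Cx.
Proof.
  intros Hz Hy. unfold cauchy_kernel. field. split; apply RtoC_sub_neq0; easy.
Qed.

Lemma Im_add_small y h : Csqnorm h < Im y * Im y / 4 ->
  Im y * Im y / 4 <= Im (y + h)%Cx * Im (y + h)%Cx /\ 0 < Im y * Im (y + h)%Cx.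
Proof. pose proof (Im_sqr_le_Csqnorm h). intros Hh. simpl. split; nra. Qed.

Lemma cauchy_kernel_increment_le y h t : Im y <> 0 -> Csqnorm h < Im y * Im y / 4 ->
  Csqnorm (cauchy_kernel (y + h) t - cauchy_kernel y t)
  <= 4 * / (Im y * Im y) * / (Im y * Im y) * Csqnorm h.
Proof.
  intros Hy Hh. pose proof (Im_sqr_gt0 y Hy) as Hy2.
  destruct (Im_add_small y h Hh) as [Hyh _].
  assert (Hyh0 : Im (y + h)%Cx <> 0) by nra.
  rewrite cauchy_kernel_resolvent by easy. replace (y + h - y)%Cx with h by ring.
  rewrite !Csqnorm_mul, Rmult_comm.
  apply Rmult_le_compat_r; [apply Csqnorm_ge0|].
  apply Rmult_le_compat; auto using Csqnorm_ge0, Csqnorm_cauchy_kernel_le.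
  eapply Rle_trans; [apply Csqnorm_cauchy_kernel_le; easy|].
  replace (4 * / (Im y * Im y)) with (/ (Im y * Im y / 4)) by (field; easy).
  apply Rinv_le_contravar; lra.
Qed.

(** * The Weyl function of a positive functional *)

Section Weyl.

Variables (L : (R -> Cx) -> Cx) (m : nat -> R) (P : nat -> nat -> R).
Hypothesis HL : positive_functional L.
Hypothesis L_moment : has_moments L m.

Definition functional_inner (f g : R -> Cx) : Cx := L (fun t => f t * Cconj (g t))%Cx.

Definition orthonormal_poly (k : nat) (t : R) : Cx := pevalC (P k) k (RtoC t).

Lemma functional_inner_semi_inner : semi_inner tempered functional_inner.
Proof.
  unfold functional_inner. split.
  - intros a b f g h Hf Hg Hh.
    rewrite <- (functional_lin L HL) by (apply tempered_mul; auto using tempered_conj).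
    apply functional_ext; intros; ring.
  - intros f g Hf Hg.
    rewrite <- (functional_conj L HL) by (apply tempered_mul; auto using tempered_conj).
    apply functional_ext; intros. rewrite Cconj_mul, Cconj_involutive. ring.
  - intros f Hf. apply (functional_ge0 L HL); [apply tempered_mul; auto using tempered_conj|].
    intros t. rewrite Cmul_conj. apply Csqnorm_ge0.
Qed.

Lemma orthonormal_poly_tempered k : tempered (orthonormal_poly k).
Proof.
  apply (tempered_csum (S k) (fun j t => RtoC (P k j) * Cpow (RtoC t) j)%Cx).
  intros j. apply tempered_scal.
  replace (fun t => Cpow (RtoC t) j) with (fun t => RtoC (t ^ j))
    by (extensionality t; rewrite Cpow_RtoC; easy).
  apply tempered_pow.
Qed.

Lemma Cconj_orthonormal_poly k t : Cconj (orthonormal_poly k t) = orthonormal_poly k t.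
Proof. unfold orthonormal_poly. rewrite Cconj_pevalC, Cconj_RtoC. easy. Qed.

Lemma functional_inner_poly f k : tempered f ->
  functional_inner f (orthonormal_poly k) =
  pairing P k (fun j => L (fun t => f t * RtoC (t ^ j))%Cx).
Proof.
  intros Hf. unfold functional_inner, pairing.
  rewrite <- (functional_csum L HL (S k) (fun j => RtoC (P k j))
    (fun j t => f t * RtoC (t ^ j))%Cx) by (intros; apply tempered_mul; auto using tempered_pow).
  apply functional_ext. intros t. rewrite Cconj_orthonormal_poly.
  unfold orthonormal_poly, pevalC. rewrite <- csum_scal. apply csum_ext. intros j _.
  rewrite Cpow_RtoC. ring.
Qed.

Lemma functional_inner_polys k l :
  functional_inner (orthonormal_poly k) (orthonormal_poly l) =
  pairing P k (fun i => pairing P l (fun j => RtoC (m (i + j)%nat))).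
Proof.
  rewrite functional_inner_poly by apply orthonormal_poly_tempered.
  rewrite pairing_swap. apply pairing_ext. intros j.
  transitivity (functional_inner (fun t => RtoC (t ^ j)) (orthonormal_poly k)).
  - unfold functional_inner. apply functional_ext. intros t.
    rewrite Cconj_orthonormal_poly. ring.
  - rewrite functional_inner_poly by apply tempered_pow. apply pairing_ext. intros i.
    rewrite Nat.add_comm, <- L_moment. apply functional_ext. intros t.
    rewrite pow_add, RtoC_mul. easy.
Qed.

Definition weyl (z : Cx) : Cx := L (cauchy_kernel z).

Lemma Cconj_weyl z : Im z <> 0 -> Cconj (weyl z) = weyl (Cconj z).
Proof.
  intros Hz. unfold weyl.
  rewrite <- (functional_conj L HL) by (apply cauchy_kernel_tempered; easy).
  apply functional_ext. intros t. apply Cconj_cauchy_kernel.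
Qed.

Lemma functional_cauchy_kernel_pow z j : Im z <> 0 ->
  L (fun t => cauchy_kernel z t * RtoC (t ^ j))%Cx = cauchy_moments m (weyl z) z j.
Proof.
  intros Hz. pose proof (cauchy_kernel_tempered z Hz) as Hk. induction j as [|j IH]; simpl.
  - apply functional_ext. intros t. change (RtoC 1) with C1. ring.
  - assert (Tj : tempered (fun t => cauchy_kernel z t * RtoC (t ^ j))%Cx)
      by (apply tempered_mul; [easy|apply tempered_pow]).
    transitivity (L (fun t => z * (cauchy_kernel z t * RtoC (t ^ j)) + C1 * RtoC (t ^ j))%Cx).
    + apply functional_ext. intros t. unfold cauchy_kernel. rewrite RtoC_mul.
      field. apply RtoC_sub_neq0; easy.
    + rewrite (functional_lin L HL _ _ _ _ Tj (tempered_pow j)), IH, L_moment. ring.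
Qed.

Lemma functional_inner_cauchy_kernel_poly z k : Im z <> 0 ->
  functional_inner (cauchy_kernel z) (orthonormal_poly k) = cauchy_coef m P (weyl z) z k.
Proof.
  intros Hz. rewrite functional_inner_poly by (apply cauchy_kernel_tempered; easy).
  apply pairing_ext. intros j. apply functional_cauchy_kernel_pow; easy.
Qed.

Lemma functional_inner_cauchy_kernels z y : Im z <> 0 -> Im y <> 0 ->
  ((z - Cconj y) * functional_inner (cauchy_kernel z) (cauchy_kernel y) =
   weyl z - weyl (Cconj y))%Cx.
Proof.
  intros Hz Hy. assert (Hy' : Im (Cconj y) <> 0) by (simpl; lra).
  pose proof (cauchy_kernel_tempered z Hz) as Tz.
  pose proof (cauchy_kernel_tempered y Hy) as Ty.
  pose proof (cauchy_kernel_tempered (Cconj y) Hy') as Ty'.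
  unfold functional_inner, weyl.
  rewrite <- (functional_scal L HL) by (apply tempered_mul; auto using tempered_conj).
  transitivity (L (fun t => C1 * cauchy_kernel z t + - C1 * cauchy_kernel (Cconj y) t)%Cx).
  - apply functional_ext. intros t.
    rewrite Cconj_cauchy_kernel, <- cauchy_kernel_resolvent by easy. ring.
  - rewrite (functional_lin L HL) by easy. ring.
Qed.

Hypothesis P_lead : forall k, 0 < P k k.
Hypothesis P_orthonormal : moment_orthonormal m P.

Lemma residual_cauchy_kernels n z y : Im z <> 0 -> Im y <> 0 ->
  ((z - Cconj y) *
     residual functional_inner orthonormal_poly (S n) (cauchy_kernel z) (cauchy_kernel y) =
   numerator_sum m P (weyl z) z n * Cconj (denominator_sum m P (weyl y) y n)
   - denominator_sum m P (weyl z) z n * Cconj (numerator_sum m P (weyl y) y n))%Cx.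
Proof.
  intros Hz Hy.
  rewrite Cconj_numerator_sum, Cconj_denominator_sum.
  rewrite (christoffel_darboux m P P_lead P_orthonormal), (Cconj_weyl y) by easy.
  rewrite <- functional_inner_cauchy_kernels by easy. unfold residual.
  rewrite (csum_ext (S n) _ (fun k => cauchy_coef m P (weyl z) z k *
    cauchy_coef m P (weyl (Cconj y)) (Cconj y) k)%Cx); [ring|].
  intros k _. rewrite !functional_inner_cauchy_kernel_poly, Cconj_cauchy_coef by easy.
  rewrite Cconj_weyl by easy. easy.
Qed.

(* The inner product of the components of two Cauchy kernels orthogonal to all polynomials. *)
Definition residual_gram (z y : Cx) : Cx :=
  residual_lim functional_inner orthonormal_poly (cauchy_kernel z) (cauchy_kernel y).

Lemma poly_orthonormal k l :
  functional_inner (orthonormal_poly k) (orthonormal_poly l) = kronecker k l.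
Proof. rewrite functional_inner_polys. apply P_orthonormal. Qed.

Lemma residual_lim_inner_semi_inner :
  semi_inner tempered (residual_lim functional_inner orthonormal_poly).
Proof.
  exact (residual_lim_semi_inner tempered tempered_lin _ _ functional_inner_semi_inner
    orthonormal_poly_tempered poly_orthonormal).
Qed.

Lemma residual_gram_cv z y : Im z <> 0 -> Im y <> 0 ->
  Cfilterlim (fun n =>
    residual functional_inner orthonormal_poly n (cauchy_kernel z) (cauchy_kernel y))
    eventually (residual_gram z y).
Proof.
  intros Hz Hy.
  exact (residual_cv tempered tempered_lin _ _ functional_inner_semi_inner
    orthonormal_poly_tempered poly_orthonormal _ _
    (cauchy_kernel_tempered z Hz) (cauchy_kernel_tempered y Hy)).
Qed.

Lemma residual_gram_ge0 z : Im z <> 0 -> 0 <= Re (residual_gram z z).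
Proof.
  intros Hz. apply (semi_inner_ge0 _ _ residual_lim_inner_semi_inner).
  apply cauchy_kernel_tempered; easy.
Qed.

Lemma residual_gram_self z : Im z <> 0 -> residual_gram z z = RtoC (Re (residual_gram z z)).
Proof.
  intros Hz. apply (semi_inner_self tempered _ residual_lim_inner_semi_inner).
  apply cauchy_kernel_tempered; easy.
Qed.

Lemma residual_gram_cauchy_schwarz z y : Im z <> 0 -> Im y <> 0 ->
  Csqnorm (residual_gram z y) <= Re (residual_gram z z) * Re (residual_gram y y).
Proof.
  intros Hz Hy.
  apply (semi_inner_cauchy_schwarz tempered tempered_lin _ residual_lim_inner_semi_inner);
    apply cauchy_kernel_tempered; easy.
Qed.

Lemma residual_gram_increment_le y y' : Im y <> 0 -> Im y' <> 0 ->
  exists K, forall h, Csqnorm h < Im y * Im y / 4 ->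
    Csqnorm (residual_gram (y + h) y' - residual_gram y y') <= K * Csqnorm h.
Proof.
  intros Hy Hy'. set (a := 4 * / (Im y * Im y) * / (Im y * Im y)).
  exists (a * Re (L (fun _ => C1)) * Re (residual_gram y' y')). intros h Hh.
  pose proof (Im_sqr_gt0 y Hy). destruct (Im_add_small y h Hh) as [Hyh _].
  assert (Hyh0 : Im (y + h)%Cx <> 0) by nra.
  pose proof (cauchy_kernel_tempered _ Hy) as Ty.
  pose proof (cauchy_kernel_tempered _ Hy') as Ty'.
  pose proof (cauchy_kernel_tempered _ Hyh0) as Th.
  set (d := fun t => (C1 * cauchy_kernel (y + h) t + - C1 * cauchy_kernel y t)%Cx).
  assert (Td : tempered d) by (apply tempered_lin; easy).
  replace (residual_gram (y + h) y' - residual_gram y y')%Cx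
    with (residual_lim functional_inner orthonormal_poly d (cauchy_kernel y')).
  2: { unfold d. rewrite (semi_inner_lin _ _ residual_lim_inner_semi_inner) by easy.
       unfold residual_gram. ring. }
  eapply Rle_trans; [apply (semi_inner_cauchy_schwarz tempered tempered_lin _
    residual_lim_inner_semi_inner); easy|].
  replace (a * Re (L (fun _ => C1)) * Re (residual_gram y' y') * Csqnorm h)
    with (a * Csqnorm h * Re (L (fun _ => C1)) * Re (residual_gram y' y')) by ring.
  apply Rmult_le_compat_r; [apply residual_gram_ge0; easy|].
  eapply Rle_trans; [apply (residual_lim_le tempered tempered_lin _ _
    functional_inner_semi_inner orthonormal_poly_tempered poly_orthonormal); easy|].
  apply (functional_le_total_mass L HL).
  - apply tempered_mul; [easy|apply tempered_conj; easy].
  - intros t. rewrite Cmul_conj. simpl. unfold d.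
    replace (C1 * cauchy_kernel (y + h) t + - C1 * cauchy_kernel y t)%Cx
      with (cauchy_kernel (y + h) t - cauchy_kernel y t)%Cx by ring.
    apply cauchy_kernel_increment_le; easy.
Qed.

End Weyl.

(** * Complex differentiability *)

Definition punctured_at_0 (Q : Cx -> Prop) : Prop :=
  exists delta, 0 < delta /\ forall h, h <> C0 -> Cnorm h < delta -> Q h.

#[local] Instance punctured_at_0_filter : Filter punctured_at_0.
Proof.
  split.
  - exists 1. split; [lra|easy].
  - intros Q Q' (d & Hd & HQ) (d' & Hd' & HQ').
    exists (Rmin d d'). split; [apply Rmin_glb_lt; easy|].
    pose proof (Rmin_l d d'). pose proof (Rmin_r d d').
    intros h Hh0 Hh. split; [apply HQ|apply HQ']; auto; lra.
  - intros Q Q' H (d & Hd & HQ). exists d. auto.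
Qed.

Lemma punctured_at_0_nonzero : punctured_at_0 (fun h => h <> C0).
Proof. exists 1. split; [lra|easy]. Qed.

Lemma punctured_at_0_Csqnorm_lt d : 0 < d -> punctured_at_0 (fun h => Csqnorm h < d).
Proof.
  intros Hd. exists (sqrt d). split; [apply sqrt_lt_R0; easy|].
  intros h _ Hh. apply sqrt_lt_0_alt. exact Hh.
Qed.

Lemma filterlim_Csqnorm_0 : filterlim Csqnorm punctured_at_0 (locally 0).
Proof.
  apply (filterlim_locally_Rabs (F := punctured_at_0)). intros eps He.
  apply filter_imp with (2 := punctured_at_0_Csqnorm_lt eps He). intros h Hh.
  rewrite Rminus_0_r, Rabs_pos_eq by apply Csqnorm_ge0. easy.
Qed.

Lemma Cfilterlim_id_0 : Cfilterlim (fun h => h) punctured_at_0 C0.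
Proof.
  apply Cfilterlim_of_Csqnorm_sub.
  apply (filterlim_ext (fun h => Csqnorm h)); [|exact filterlim_Csqnorm_0].
  intros h. f_equal. ring.
Qed.

Lemma Cfilterlim_of_Csqnorm_le u l K d : 0 < d ->
  (forall h, Csqnorm h < d -> Csqnorm (u h - l) <= K * Csqnorm h) ->
  Cfilterlim u punctured_at_0 l.
Proof.
  intros Hd H. apply Cfilterlim_of_Csqnorm_sub.
  apply (filterlim_le_le (F := punctured_at_0) (fun _ => 0) _ (fun h => K * Csqnorm h)
    (Finite 0)).
  - apply filter_imp with (2 := punctured_at_0_Csqnorm_lt d Hd). intros h Hh.
    split; [apply Csqnorm_ge0|apply H; easy].
  - exact (filterlim_const 0).
  - change (filterlim (fun h => K * Csqnorm h) punctured_at_0 (locally 0)).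
    rewrite <- (Rmult_0_r K).
    apply filterlim_Rmult; [apply filterlim_const|exact filterlim_Csqnorm_0].
Qed.

Lemma holomorphic_upper_of_Cfilterlim f :
  (forall z, upper z -> exists l,
    Cfilterlim (fun h => (f (z + h) - f z) / h)%Cx punctured_at_0 l) ->
  holomorphic_upper f.
Proof.
  intros H z Hz. destruct (H z Hz) as [l Hl]. exists l.
  exact (Cfilterlim_Cnorm_sub (F := punctured_at_0) _ _ Hl).
Qed.

Lemma holomorphic_upper_const c : holomorphic_upper (fun _ => c).
Proof.
  apply holomorphic_upper_of_Cfilterlim. intros z _. exists C0.
  apply (Cfilterlim_ext_loc (fun _ => C0)); [|apply Cfilterlim_const].
  apply filter_imp with (2 := punctured_at_0_nonzero). intros h Hh. field. easy.
Qed.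

(** * Nevanlinna parametrization *)

Lemma Cser_cv_Cfilterlim u l :
  Cser_cv u l -> Cfilterlim (fun n => csum (S n) u) eventually l.
Proof. intros [HRe HIm]. split; apply is_lim_seq_Reals; easy. Qed.

Lemma pevalC_RtoC p n x : pevalC p n (RtoC x) = RtoC (pevalR p n x).
Proof.
  unfold pevalC, pevalR. induction (S n) as [|k IH]; simpl; [easy|].
  rewrite IH, Cpow_RtoC. apply Cx_eq; simpl; ring.
Qed.

Section Nevanlinna.

Variables (L : (R -> Cx) -> Cx) (m : nat -> R) (P : nat -> nat -> R).
Hypothesis HL : positive_functional L.
Hypothesis L_moment : has_moments L m.
Hypothesis P_lead : forall k, 0 < P k k.
Hypothesis P_orthonormal : moment_orthonormal m P.
Variables A B C D : Cx -> Cx.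
Hypothesis HN : nevanlinna_matrix P (fun k z => cauchy_coef m P C0 z k) A B C D.

Let w : Cx -> Cx := weyl L.
Let F (z : Cx) : Cx := (C z + w z * D z)%Cx.
Let E (z : Cx) : Cx := (A z + w z * B z)%Cx.
Let gram : Cx -> Cx -> Cx := residual_gram L P.

Lemma cauchy_coef_series_cv q v z X Y :
  Cser_cv (fun k => z * (q k * cauchy_coef m P C0 z k))%Cx X ->
  Cser_cv (fun k => z * (q k * pevalC (P k) k z))%Cx Y ->
  Cfilterlim (fun n => z * csum (S n) (fun k => cauchy_coef m P v z k * q k))%Cx eventually
    (X + v * Y)%Cx.
Proof.
  intros HX%Cser_cv_Cfilterlim HY%Cser_cv_Cfilterlim.
  eapply Cfilterlim_ext; [|apply Cfilterlim_add;
    [exact HX|apply Cfilterlim_mul; [apply Cfilterlim_const|exact HY]]].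
  intros n. cbv beta. rewrite <- !csum_scal, <- csum_plus. apply csum_ext. intros k _.
  rewrite (cauchy_coef_split m P v). ring.
Qed.

Lemma numerator_sum_cv v z :
  Cfilterlim (numerator_sum m P v z) eventually (C z + v * D z)%Cx.
Proof.
  destruct (HN z) as (_ & _ & HC & HD).
  replace (C z + v * D z)%Cx with (C1 + ((C z - C1) + v * D z))%Cx by ring.
  apply Cfilterlim_add; [apply Cfilterlim_const|].
  apply (Cfilterlim_ext (fun n => z *
    csum (S n) (fun k => cauchy_coef m P v z k * RtoC (pevalR (P k) k 0)))%Cx).
  - intros n. f_equal. apply csum_ext. intros k _. rewrite <- pevalC_RtoC. easy.
  - apply (cauchy_coef_series_cv (fun k => RtoC (pevalR (P k) k 0))); easy.
Qed.

Lemma denominator_sum_cv v z :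
  Cfilterlim (denominator_sum m P v z) eventually (A z + v * B z)%Cx.
Proof.
  destruct (HN z) as (HA & HB & _ & _).
  replace (A z + v * B z)%Cx with (- v + (A z + v * (B z + C1)))%Cx by ring.
  apply Cfilterlim_add; [apply Cfilterlim_const|].
  apply (cauchy_coef_series_cv (cauchy_coef m P C0 C0)); easy.
Qed.

Lemma nevanlinna_det z : (A z * D z - B z * C z)%Cx = C1.
Proof.
  apply (Cfilterlim_unique (F := eventually)
    (fun n => numerator_sum m P C1 z n * denominator_sum m P C0 z n
      - denominator_sum m P C1 z n * numerator_sum m P C0 z n)%Cx).
  - replace (A z * D z - B z * C z)%Cx
      with ((C z + C1 * D z) * (A z + C0 * B z) - (A z + C1 * B z) * (C z + C0 * D z))%Cx
      by ring.
    apply Cfilterlim_sub; apply Cfilterlim_mul.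
    + apply numerator_sum_cv.
    + apply denominator_sum_cv.
    + apply denominator_sum_cv.
    + apply numerator_sum_cv.
  - apply (Cfilterlim_ext (fun _ => C1)); [|apply Cfilterlim_const].
    intros n. rewrite (christoffel_darboux m P P_lead P_orthonormal). ring.
Qed.

Lemma numerator_denominator_not_both_0 z : F z = C0 -> E z = C0 -> False.
Proof.
  intros HF HE. apply C1_neq_C0. rewrite <- (nevanlinna_det z).
  transitivity (D z * E z - B z * F z)%Cx; [unfold E, F; ring|].
  rewrite HF, HE. ring.
Qed.

Lemma weyl_combination_conj (u : Cx -> Cx -> nat -> Cx) X Y z :
  (forall v y, Cfilterlim (u v y) eventually (X y + v * Y y)%Cx) ->
  (forall v y n, Cconj (u v y n) = u (Cconj v) (Cconj y) n) -> Im z <> 0 ->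
  (X (Cconj z) + w (Cconj z) * Y (Cconj z))%Cx = Cconj (X z + w z * Y z).
Proof.
  intros Hlim Hconj Hz.
  apply (Cfilterlim_unique (F := eventually) (u (w (Cconj z)) (Cconj z))); [apply Hlim|].
  apply (Cfilterlim_ext (fun n => Cconj (u (w z) z n))); [|apply Cfilterlim_conj, Hlim].
  intros n. rewrite Hconj. unfold w. rewrite Cconj_weyl by easy. easy.
Qed.

Lemma numerator_conj z : Im z <> 0 -> F (Cconj z) = Cconj (F z).
Proof.
  exact (weyl_combination_conj _ C D z numerator_sum_cv (Cconj_numerator_sum m P)).
Qed.

Lemma denominator_conj z : Im z <> 0 -> E (Cconj z) = Cconj (E z).
Proof.
  exact (weyl_combination_conj _ A B z denominator_sum_cv (Cconj_denominator_sum m P)).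
Qed.

Lemma gram_identity z y : Im z <> 0 -> Im y <> 0 ->
  ((z - Cconj y) * gram z y = F z * Cconj (E y) - E z * Cconj (F y))%Cx.
Proof.
  intros Hz Hy.
  apply (Cfilterlim_unique (F := eventually) (fun n => (z - Cconj y) *
    residual (functional_inner L) (orthonormal_poly P) (S n)
      (cauchy_kernel z) (cauchy_kernel y))%Cx).
  - apply Cfilterlim_mul; [apply Cfilterlim_const|].
    apply (Cfilterlim_S (fun n => residual (functional_inner L) (orthonormal_poly P) n
      (cauchy_kernel z) (cauchy_kernel y))).
    apply (residual_gram_cv L m P); easy.
  - eapply Cfilterlim_ext.
    + intros n. symmetry. apply (residual_cauchy_kernels L m P); easy.
    + apply Cfilterlim_sub; apply Cfilterlim_mul.
      * apply numerator_sum_cv.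
      * apply Cfilterlim_conj, denominator_sum_cv.
      * apply denominator_sum_cv.
      * apply Cfilterlim_conj, numerator_sum_cv.
Qed.

Lemma gram_conj_identity z y : Im z <> 0 -> Im y <> 0 ->
  ((z - y) * gram z (Cconj y) = F z * E y - E z * F y)%Cx.
Proof.
  intros Hz Hy. pose proof (gram_identity z (Cconj y) Hz ltac:(simpl; lra)) as H.
  rewrite numerator_conj, denominator_conj, !Cconj_involutive in H by easy. exact H.
Qed.

Lemma Im_mul_gram_self z : Im z <> 0 ->
  Im z * Re (gram z z) = Im (F z * Cconj (E z))%Cx.
Proof.
  intros Hz. pose proof (f_equal Im (gram_identity z z Hz Hz)) as H.
  unfold gram in *.
  rewrite (residual_gram_self L m P HL L_moment P_orthonormal z Hz) in H. simpl in *. lra.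
Qed.

Lemma gram_continuous y y' : Im y <> 0 -> Im y' <> 0 ->
  Cfilterlim (fun h => gram (y + h)%Cx y') punctured_at_0 (gram y y').
Proof.
  intros Hy Hy'. pose proof (Im_sqr_gt0 y Hy).
  destruct (residual_gram_increment_le L m P HL L_moment P_orthonormal y y' Hy Hy') as [K HK].
  apply (Cfilterlim_of_Csqnorm_le _ _ K (Im y * Im y / 4)); [lra|easy].
Qed.

Lemma punctured_at_0_upper y : upper y -> punctured_at_0 (fun h => h <> C0 /\ upper (y + h)%Cx).
Proof.
  intros Hy. unfold upper in *.
  apply filter_and; [exact punctured_at_0_nonzero|].
  apply filter_imp with (2 := punctured_at_0_Csqnorm_lt (Im y * Im y / 4) ltac:(nra)).
  intros h Hh. destruct (Im_add_small y h Hh) as [_ H]. nra.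
Qed.

Lemma nev_transform_quotient z f : E z <> C0 -> f z = (F z / E z)%Cx ->
  nev_transform A B C D (Some f) z = w z.
Proof.
  intros HE Hf. unfold nev_transform. rewrite Hf.
  assert (Hnum : (A z * (F z / E z) - C z = w z / E z)%Cx).
  { transitivity (w z * (A z * D z - B z * C z) / E z)%Cx.
    - unfold F, E in *. field. easy.
    - rewrite nevanlinna_det. field. easy. }
  assert (Hden : (B z * (F z / E z) - D z = - C1 / E z)%Cx).
  { rewrite <- (nevanlinna_det z). unfold F, E in *. field. easy. }
  rewrite Hnum, Hden. field. split; [easy|].
  intros H. apply (f_equal Re) in H. simpl in H. lra.
Qed.

Lemma nev_transform_infinity z : E z = C0 -> nev_transform A B C D None z = w z.
Proof.
  intros HE. assert (HA : A z = (- (w z * B z))%Cx).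
  { transitivity (E z - w z * B z)%Cx; [unfold E; ring|rewrite HE; ring]. }
  assert (HB : B z <> C0).
  { intros HB. apply C1_neq_C0. rewrite <- (nevanlinna_det z), HA, HB. ring. }
  simpl. rewrite HA. field. easy.
Qed.

Lemma degenerate_parametrization y : upper y -> Re (gram y y) = 0 ->
  exists phi, in_N phi /\ forall z, upper z -> nev_transform A B C D phi z = w z.
Proof.
  unfold upper. intros Hy Hg. assert (Hyc : Im (Cconj y) <> 0) by (simpl; lra).
  pose proof (Im_mul_gram_self y ltac:(lra)) as Hself. rewrite Hg, Rmult_0_r in Hself.
  assert (Hgc : Re (gram (Cconj y) (Cconj y)) = 0).
  { apply Rmult_eq_reg_l with (Im (Cconj y)); [|easy].
    rewrite Im_mul_gram_self, numerator_conj, denominator_conj by (easy || lra).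
    simpl in *. lra. }
  assert (Hprop : forall z, upper z -> (F z * E y = E z * F y)%Cx).
  { unfold upper. intros z Hz. apply Csub_eq0.
    rewrite <- gram_conj_identity by lra.
    replace (gram z (Cconj y)) with C0; [ring|]. symmetry. apply Csqnorm_eq0, Rle_antisym;
      [|apply Csqnorm_ge0].
    eapply Rle_trans; [apply (residual_gram_cauchy_schwarz L m P); auto; lra|].
    fold gram. rewrite Hgc. lra. }
  destruct (classic (E y = C0)) as [HE|HE].
  - exists None. split; [easy|]. intros z Hz. apply nev_transform_infinity.
    destruct (Cmul_integral (E z) (F y)) as [|HF]; [|easy|].
    + rewrite <- Hprop, HE by easy. ring.
    + exfalso. apply (numerator_denominator_not_both_0 y); easy.
  - exists (Some (fun _ => F y / E y)%Cx). split.
    + split; [apply holomorphic_upper_const|]. intros _ _.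
      rewrite Im_div, <- Hself by easy. unfold Rdiv. lra.
    + intros z Hz.
      assert (Ez : E z <> C0).
      { intros Ez. apply (numerator_denominator_not_both_0 z); [|easy].
        destruct (Cmul_integral (F z) (E y)); [|easy|easy].
        rewrite Hprop, Ez by easy. ring. }
      apply nev_transform_quotient; [easy|].
      transitivity (F z * E y / (E z * E y))%Cx; [rewrite Hprop by easy; field|field]; auto.
Qed.

Section Nondegenerate.

Hypothesis gram_gt0 : forall y, upper y -> 0 < Re (gram y y).

Lemma denominator_neq0 y : upper y -> E y <> C0.
Proof.
  intros Hy HE. pose proof (Rmult_lt_0_compat _ _ Hy (gram_gt0 y Hy)) as Hpos.
  unfold upper in Hy. rewrite Im_mul_gram_self, HE, Cconj_C0 in Hpos by lra.
  simpl in Hpos. lra.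
Qed.

Lemma mul_gram_self_neq0 y : upper y -> ((y - Cconj y) * gram y y)%Cx <> C0.
Proof.
  intros Hy H. pose proof (gram_gt0 y Hy) as Hg. unfold upper in Hy.
  destruct (Cmul_integral _ _ H) as [H'|H'].
  - apply (f_equal Im) in H'. simpl in H'. lra.
  - rewrite H' in Hg. simpl in Hg. lra.
Qed.

(* Obtained by eliminating [F z] between [gram_identity] and [gram_conj_identity]. *)
Lemma denominator_eq_gram_quotient y z : upper y -> upper z ->
  ((E y * ((z - Cconj y) * gram z y) - Cconj (E y) * ((z - y) * gram z (Cconj y)))
    / ((y - Cconj y) * gram y y) = E z)%Cx.
Proof.
  intros Hy Hz. pose proof (mul_gram_self_neq0 y Hy) as Hden. unfold upper in *.
  rewrite gram_identity in Hden by lra.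
  rewrite gram_conj_identity, !gram_identity by lra. field. easy.
Qed.

Lemma denominator_continuous y : upper y ->
  Cfilterlim (fun h => E (y + h)%Cx) punctured_at_0 (E y).
Proof.
  intros Hy. assert (Hy0 : Im y <> 0) by (unfold upper in Hy; lra).
  assert (Shift : forall c,
    Cfilterlim (fun h => y + h - c)%Cx punctured_at_0 (y - c)%Cx).
  { intros c. apply Cfilterlim_sub; [|apply Cfilterlim_const].
    replace y with (y + C0)%Cx at 2 by ring.
    apply Cfilterlim_add; [apply Cfilterlim_const|apply Cfilterlim_id_0]. }
  assert (Lim : Cfilterlim (fun h =>
    ((E y * ((y + h - Cconj y) * gram (y + h) y)
      - Cconj (E y) * ((y + h - y) * gram (y + h) (Cconj y)))
      / ((y - Cconj y) * gram y y))%Cx) punctured_at_0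
    ((E y * ((y - Cconj y) * gram y y) - Cconj (E y) * ((y - y) * gram y (Cconj y)))
      / ((y - Cconj y) * gram y y))%Cx).
  { apply Cfilterlim_div;
      [apply mul_gram_self_neq0; easy| |apply Cfilterlim_const].
    apply Cfilterlim_sub; (apply Cfilterlim_mul; [apply Cfilterlim_const|]);
      (apply Cfilterlim_mul; [apply Shift|apply gram_continuous; simpl; lra]). }
  rewrite (denominator_eq_gram_quotient y y Hy Hy) in Lim.
  revert Lim. apply Cfilterlim_ext_loc.
  apply filter_imp with (2 := punctured_at_0_upper y Hy). intros h [_ Hh].
  apply denominator_eq_gram_quotient; easy.
Qed.

Lemma quotient_holomorphic : holomorphic_upper (fun z => F z / E z)%Cx.
Proof.
  apply holomorphic_upper_of_Cfilterlim. intros y Hy.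
  assert (Hyc : Im (Cconj y) <> 0) by (unfold upper in Hy; simpl; lra).
  pose proof (denominator_neq0 y Hy) as HE.
  exists (gram y (Cconj y) / (E y * E y))%Cx.
  apply (Cfilterlim_ext_loc (fun h => gram (y + h)%Cx (Cconj y) / (E (y + h)%Cx * E y))%Cx).
  - apply filter_imp with (2 := punctured_at_0_upper y Hy). intros h [Hh0 Hh].
    pose proof (denominator_neq0 _ Hh) as HEh. unfold upper in *.
    transitivity ((y + h - y) * gram (y + h)%Cx (Cconj y) / (h * E (y + h)%Cx * E y))%Cx;
      [field; auto|].
    rewrite gram_conj_identity by lra. field. auto.
  - apply Cfilterlim_div.
    + intros H. apply Cmul_integral in H. tauto.
    + apply gram_continuous; [unfold upper in Hy; lra|easy].
    + apply Cfilterlim_mul; [apply denominator_continuous; easy|apply Cfilterlim_const].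
Qed.

Lemma nondegenerate_parametrization :
  exists phi, in_N phi /\ forall z, upper z -> nev_transform A B C D phi z = w z.
Proof.
  exists (Some (fun z => F z / E z)%Cx). split; [split; [exact quotient_holomorphic|]|].
  - intros z Hz. pose proof (denominator_neq0 z Hz) as HE. pose proof (gram_gt0 z Hz).
    pose proof (Csqnorm_gt0 _ HE). unfold upper in Hz.
    rewrite Im_div, <- Im_mul_gram_self by (easy || lra).
    left. apply Rdiv_lt_0_compat; [apply Rmult_lt_0_compat|]; easy.
  - intros z Hz. apply nev_transform_quotient; [apply denominator_neq0; easy|easy].
Qed.

End Nondegenerate.

Lemma nevanlinna_parametrization :
  exists phi, in_N phi /\ forall z, upper z -> nev_transform A B C D phi z = weyl L z.
Proof.
  destruct (classic (exists y, upper y /\ Re (gram y y) = 0)) as [(y & Hy & Hg)|H].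
  - apply degenerate_parametrization with y; easy.
  - apply nondegenerate_parametrization. intros y Hy.
    destruct (residual_gram_ge0 L m P HL L_moment P_orthonormal y) as [|Hg]; [|easy|].
    + unfold upper in Hy. lra.
    + exfalso. apply H. exists y. easy.
Qed.

End Nevanlinna.

Lemma second_kind_cauchy_coef m s P Q : moment_solution m s -> second_kind s P Q ->
  Q = fun k z => cauchy_coef m P C0 z k.
Proof.
  intros Hs HQ. extensionality k. extensionality z.
  pose proof (stieltjes_positive m s Hs) as HL.
  rewrite <- (stieltjes_unique _ _ _ (HQ k z)). unfold divdiff.
  rewrite (functional_csum _ HL (S k) (fun j => RtoC (P k j))
    (fun j x => csum j (fun i => Cpow z i * RtoC (x ^ (j - 1 - i))))%Cx).
  - apply pairing_ext. intros j. rewrite cauchy_moments_csum.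
    rewrite (functional_csum _ HL j (Cpow z) (fun i x => RtoC (x ^ (j - 1 - i))))
      by (intros; apply tempered_pow).
    apply csum_ext. intros i _. rewrite (stieltjes_moments m s Hs). easy.
  - intros j. apply (tempered_csum j (fun i x => Cpow z i * RtoC (x ^ (j - 1 - i)))%Cx).
    intros i. apply tempered_scal, tempered_pow.
Qed.

Lemma orthonormal_polys_moment_orthonormal m s P :
  moment_solution m s -> orthonormal_polys s P -> moment_orthonormal m P.
Proof.
  intros Hs (_ & _ & HP) k l.
  rewrite <- (functional_inner_polys (stieltjes s) m P (stieltjes_positive m s Hs)
    (stieltjes_moments m s Hs)).
  unfold functional_inner, orthonormal_poly.
  replace (fun t => (pevalC (P k) k (RtoC t) * Cconj (pevalC (P l) l (RtoC t)))%Cx)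
    with (fun t => RtoC (pevalR (P k) k t * pevalR (P l) l t))
    by (extensionality t; rewrite !pevalC_RtoC, Cconj_RtoC, RtoC_mul; easy).
  replace (kronecker k l) with (RtoC (if Nat.eqb k l then 1 else 0))
    by (unfold kronecker; destruct (Nat.eqb k l); easy).
  apply stieltjes_unique, CRS_int_R_RtoC, HP.
Qed.

Theorem mainTheorem9 :
  forall (s : nat -> R) (d l0 : nat) (sigma : R -> R),
    positive_seq s ->
    (1 <= d)%nat ->
    Nat.even l0 = true ->
    moment_solution s sigma ->
    indeterminate (fun k => s (k * d + l0)%nat) ->
    forall (sigt : R -> R) (P : nat -> nat -> R) (Q : nat -> Cx -> Cx)
           (A B C D : Cx -> Cx),
      moment_solution (fun k => s (k * d + l0)%nat) sigt ->
      orthonormal_polys sigt P ->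
      second_kind sigt P Q ->
      nevanlinna_matrix P Q A B C D ->
      exists phi : option (Cx -> Cx),
        in_N phi /\
        forall lam : Cx, 0 < Im lam ->
          CRS_int_R (fun x => Cdiv (RtoC (x ^ l0)) (Csub (RtoC (x ^ d)) lam))
                    sigma (nev_transform A B C D phi lam).
Proof.
  intros s d l0 sigma _ _ Hl0 Hsigma _ sigt P Q A B C D Hsigt HP HQ HN.
  rewrite (second_kind_cauchy_coef _ _ _ _ Hsigt HQ) in HN.
  set (L := power_pullback d l0 (stieltjes sigma)).
  destruct (nevanlinna_parametrization L (fun k => s (k * d + l0)%nat) P
    (power_pullback_positive d l0 _ Hl0 (stieltjes_positive s sigma Hsigma))
    (power_pullback_moments s sigma Hsigma d l0)
    (proj1 (proj2 HP)) (orthonormal_polys_moment_orthonormal _ _ _ Hsigt HP) A B C D HN)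
    as (phi & Hphi & Hweyl).
  exists phi. split; [exact Hphi|]. intros lam Hlam. rewrite Hweyl by exact Hlam.
  apply (stieltjes_correct s sigma Hsigma).
  apply (tempered_power_pullback d l0 (cauchy_kernel lam)), cauchy_kernel_tempered. lra.
Qed.
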